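(* Let $k\ge1$ and $D=(d_1,\dots,d_{k+1})\in\mathbb Z_{\ge0}^{k+1}$ with $d_{k+1}\in\{0,1\}$. Then the subspace $L^D\subset F^{\otimes k}$ is closed with respect to the action of $\widehat{\mathfrak{sl}}_2$ on $F^{\otimes k}$.
   Context: $\widehat{\mathfrak{sl}}_2=\mathfrak{sl}_2\otimes\mathbb C[z,z^{-1}]\oplus\mathbb Cc$, $x_i=x\otimes z^i$, $c$ central, $[x_i,y_j]=[x,y]_{i+j}-i\delta_{i+j,0}(x,y)c$, $(x,y)=\mathrm{tr}(xy)$; $e,f,h$ is the standard basis of $\mathfrak{sl}_2$. The fermionic space $F$: let $\psi(i),\phi(i)$, $i\in\mathbb Z$, be mutually anticommuting variables with zero squares. $F$ has basis the semi-infinite monomials $\dots\psi(N-1)\phi(N-1)\psi(N)\phi(N)\,\psi(i_1)\cdots\psi(i_s)\,\phi(j_1)\cdots\phi(j_t)$, $N<i_1<\dots<i_s$, $N<j_1<\dots<j_t$. $\psi(i),\phi(i)$ act by right multiplication, $\psi^*(i),\phi^*(i)$ by (right) differentiation with respect to $\psi(-i),\phi(-i)$, so $[\psi^*(i),\psi(j)]_+=[\phi^*(i),\phi(j)]_+=\delta_{i+j,0}$ and all other anticommutators vanish. $\widehat{\mathfrak{sl}}_2$ acts on $F$ with $c=1$ by $e(z)=\sum_ie_iz^i=\psi(z)\phi(z)$, $f(z)=\sum_if_iz^i=\phi^*(z)\psi^*(z)$ (where $a(z)=\sum_ia(i)z^i$), with $h_i$ determined by the commutation relations. $F^{\otimes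 k}$ is then a level $k$ module. Put $v(2N)=\dots\psi(N-1)\phi(N-1)\psi(N)$, $v(2N+1)=\dots\psi(N-1)\phi(N-1)\psi(N)\phi(N)$. Definition of $L^D$: let $n=d_1+\cdots+d_{k+1}$ and $\beta_i=d_{i+1}+\cdots+d_{k+1}$, $i=1,\dots,k$. For $s\ge1$ put $$w_s=v(-\beta_1-2s)\otimes\cdots\otimes v(-\beta_k-2s),\qquad M_s=\mathbb C[e_{-(n+2s)+1},\dots,e_{-1},e_0]\,w_s\subset F^{\otimes k}.$$ The subspaces $M_s$ are $\mathfrak{sl}_2\otimes\mathbb C[z^{-1}]$-submodules and form an increasing chain $M_1\subset M_2\subset\cdots$; $L^D=\bigcup_{s\ge1}M_s$ (as a limit of fusion products, $L^D=(\mathbb C^1)^{*d_1}*\cdots*(\mathbb C^k)^{*d_k}*(\mathbb C^{k+1})^{*(d_{k+1}+2\infty)}$). *)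

(* Defs.v *)
From HB Require Import structures.
From mathcomp Require Import all_boot all_order all_algebra finmap.
From mathcomp Require Import monalg.
From mathcomp Require Import complex zify.
From mathcomp Require Import boolp classical_sets cardinality fsbigop reals.

Set Implicit Arguments.
Unset Strict Implicit.
Unset Printing Implicit Defensive.

Import Order.TTheory GRing.Theory Num.Theory.

Local Open Scope fset_scope.
Local Open Scope classical_set_scope.
Local Open Scope ring_scope.

(* The variables are numbered in the order in which they occur in a
   semi-infinite monomial: psi(i) has number 2i and phi(i) has number 2i+1.
   A semi-infinite monomial is determined, up to sign, by the set of its
   variables, which contains all numbers q << 0 and no number q >> 0; the basis
   vector of F attached to such a set is the monomial written with increasing
   numbers.  The set is encoded by its (finite) symmetric difference with the
   set of all negative numbers. *)
Notation monomial := {fset int}.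

Definition occupied (S : monomial) (q : int) : bool := (q < 0) (+) (q \in S).

(* The finite set of the variables of S that stand to the right of p. *)
Definition above (p : int) (S : monomial) : {fset int} :=
  [fset q in (S `|` [fset - (j.+1)%:Z | j in iota 0 `|p|%N])%fset
     | occupied S q && (p < q)].

Lemma in_above p S q : (q \in above p S) = occupied S q && (p < q).
Proof.
rewrite !inE; case: (boolP (occupied S q && (p < q))) => [|_]; last first.
  by rewrite andbF.
case/andP; rewrite /occupied andbT; case: (q \in S) => //=.
rewrite addbF => q0 pq; apply/imfsetP => /=.
exists `|q|%N.-1; last by lia.
by rewrite /= mem_iota; lia.
Qed.

Definition toggle (p : int) (S : monomial) : monomial :=
  (if p \in S then S `\ p else p |` S)%fset.

(* [vac m] is the monomial whose variables are those of number <= m, so that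
   the paper's v(2N) and v(2N+1) are both instances of it. *)
Definition vac (m : int) : monomial :=
  [fset q in ([fset j%:Z | j in iota 0 `|m|%N.+1]
              `|` [fset - (j.+1)%:Z | j in iota 0 `|m|%N])%fset
     | (q < 0) (+) (q <= m)].

Lemma occupied_vac m q : occupied (vac m) q = (q <= m).
Proof.
suff H : (q \in vac m) = (q < 0) (+) (q <= m).
  by rewrite /occupied H; case: (q < 0); case: (q <= m).
rewrite !inE; case: (boolP ((q < 0) (+) (q <= m))) => [|_]; last first.
  by rewrite andbF.
rewrite andbT; case: (ltP q 0) => q0 h; apply/orP; [right | left];
  apply/imfsetP => /=.
  exists `|q|%N.-1; last by lia.
  by rewrite /= mem_iota; lia.
exists `|q|%N; last by lia.
by rewrite -[_ :: _]/(iota 0 `|m|%N.+1) mem_iota; lia.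
Qed.

Section Fock.
Variable K : fieldType.

(* Linear extension of a map given on the basis of a free module. *)
Definition linext (I : choiceType) (V : lmodType K) (f : I -> V)
    (v : {malg K[I]}) : V :=
  \sum_(x <- msupp v) v@_x *: f x.

Definition fock := {malg K[monomial]}.

Definition vsign (p : int) (S : monomial) : K := (-1) ^+ #|` above p S|.

(* Right multiplication by the variable number p, and right differentiation
   with respect to it. *)
Definition create (p : int) : fock -> fock :=
  linext (fun S : monomial =>
    if occupied S p then 0 else << vsign p S *g toggle p S >> : fock).

Definition annih (p : int) : fock -> fock :=
  linext (fun S : monomial =>
    if occupied S p then << vsign p S *g toggle p S >> : fock else 0).

Definition psi (i : int) := create (2 * i).
Definition phi (i : int) := create (2 * i + 1).
Definition psi_star (i : int) := annih (2 * - i).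
Definition phi_star (i : int) := annih (2 * - i + 1).

Lemma occupied_toggle p q S : p != q -> occupied (toggle p S) q = occupied S q.
Proof.
rewrite /occupied /toggle eq_sym => /negbTE pq; congr addb.
by case: ifP => _; rewrite !inE pq.
Qed.

(* Every vector lies between two vacua. *)
Lemma occupied_bound (v : fock) : exists B : int, forall S q, S \in msupp v ->
  (q < - B -> occupied S q) /\ (B < q -> ~~ occupied S q).
Proof.
exists (\sum_(S <- msupp v) \sum_(q <- S) `|q|) => S q Sv.
have h : q \in S -> `|q| <= \sum_(S <- msupp v) \sum_(q <- S) `|q|.
  move=> qS; rewrite (big_rem S) //= (big_rem q) //= -addrA lerDl addr_ge0 //.
    by apply: sumr_ge0.
  by apply: sumr_ge0 => ? _; apply: sumr_ge0.
have B0 : 0 <= \sum_(S <- msupp v) \sum_(q <- S) `|q|.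
  by apply: sumr_ge0 => ? _; apply: sumr_ge0.
by rewrite /occupied; split=> bq; case: (boolP (q \in S)) => [/h|_]; lia.
Qed.

Lemma create_eq0 p (v : fock) :
  (forall S, S \in msupp v -> occupied S p) -> create p v = 0.
Proof.
move=> h; rewrite /create /linext big_seq big1 // => S Sv.
by rewrite h // scaler0.
Qed.

Lemma annih_eq0 p (v : fock) :
  (forall S, S \in msupp v -> ~~ occupied S p) -> annih p v = 0.
Proof.
move=> h; rewrite /annih /linext big_seq big1 // => S Sv.
by rewrite (negbTE (h _ Sv)) scaler0.
Qed.

Lemma msupp_linext (I : choiceType) (f : I -> fock) (v : {malg K[I]}) T :
  T \in msupp (linext f v) -> exists2 S, S \in msupp v & T \in msupp (f S).
Proof.
rewrite -mcoeff_neq0; apply: contra_neqP => h.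
rewrite /linext raddf_sum /= big_seq big1 // => S Sv; rewrite mcoeffZ.
rewrite (_ : (f S)@_T = 0) ?mulr0 //; apply/eqP; rewrite mcoeff_eq0.
by apply/negP => TS; apply: h; exists S.
Qed.

Lemma msupp_create p (v : fock) T : T \in msupp (create p v) ->
  exists2 S, S \in msupp v & T = toggle p S.
Proof.
case/msupp_linext => S Sv; case: ifP; first by rewrite msupp0 inE.
by move=> _ /(fsubsetP msuppU_le); rewrite inE => /eqP ->; exists S.
Qed.

Lemma msupp_annih p (v : fock) T : T \in msupp (annih p v) ->
  exists2 S, S \in msupp v & T = toggle p S.
Proof.
case/msupp_linext => S Sv; case: ifP; last by rewrite msupp0 inE.
by move=> _ /(fsubsetP msuppU_le); rewrite inE => /eqP ->; exists S.
Qed.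

Lemma finite_int_bound (A : set int) (B : int) :
  (forall a, A a -> `|a| <= B) -> finite_set A.
Proof.
move=> h; apply: (@sub_finite_set _ _
  [set` [fset (j%:Z - B) | j in iota 0 (absz B + absz B).+1]%fset]); last first.
  exact: finite_fset.
move=> a /h aB; apply/imfsetP; exists (absz (a + B)); last by lia.
change (absz (a + B) \in iota 0 (absz B + absz B).+1).
by rewrite mem_iota; lia.
Qed.

Lemma e_op_finite i (v : fock) :
  finite_set [set a | psi a (phi (i - a) v) != 0].
Proof.
have [B hB] := occupied_bound v.
apply: (@finite_int_bound _ (`|B| + `|i| + 1)) => a /=; apply: contraNT => aB.
have [a0|a0] := ltP a 0; last first.
  have -> : phi (i - a) v = 0.
    by apply: create_eq0 => S Sv; apply: (hB _ _ Sv).1; lia.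
  by rewrite /psi create_eq0 // => S; rewrite msupp0.
rewrite /psi create_eq0 // => _ /msupp_create [S Sv ->].
by rewrite occupied_toggle; [apply: (hB _ _ Sv).1|]; lia.
Qed.

Lemma f_op_finite i (v : fock) :
  finite_set [set a | phi_star a (psi_star (i - a) v) != 0].
Proof.
have [B hB] := occupied_bound v.
apply: (@finite_int_bound _ (`|B| + `|i| + 1)) => a /=; apply: contraNT => aB.
have [a0|a0] := ltP a 0; last first.
  have -> : psi_star (i - a) v = 0.
    by apply: annih_eq0 => S Sv; apply: (hB _ _ Sv).2; lia.
  by rewrite /phi_star annih_eq0 // => S; rewrite msupp0.
rewrite /phi_star annih_eq0 // => _ /msupp_annih [S Sv ->].
by rewrite occupied_toggle; [apply: (hB _ _ Sv).2|]; lia.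
Qed.

(* Coefficients of e(z) = psi(z) phi(z) and f(z) = phi^*(z) psi^*(z).  The sums
   are finite on every vector, see [e_op_finite] and [f_op_finite]. *)
Definition e_op (i : int) (v : fock) : fock :=
  \sum_(a \in [set: int]) psi a (phi (i - a) v).

Definition f_op (i : int) (v : fock) : fock :=
  \sum_(a \in [set: int]) phi_star a (psi_star (i - a) v).

(* [x_i, y_j] = [x, y]_(i+j) - i delta_(i+j,0) (x, y) c yields h_i = [e_0, f_i]. *)
Definition h_op (i : int) (v : fock) : fock :=
  e_op 0 (f_op i v) - f_op i (e_op 0 v).

(* The vector space sl_2 (x) C[z, z^-1] (+) C c: [loop x] is a Laurent polynomial
   with matrix coefficients, (loop x)@_i being the coefficient of z^i. *)
Record sl2hat := Sl2hat {
  loop : {malg 'M[K]_2[int]};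
  central : K;
  loop_traceless : forall i : int, \tr (loop@_i) = 0
}.

(* The action on F: the matrix X = [[a, b], [c, -a]] is a h + b e + c f, and the
   central element acts by 1. *)
Definition fock_act (x : sl2hat) (v : fock) : fock :=
  \sum_(i <- msupp (loop x))
     ((loop x)@_i 0 0 *: h_op i v + (loop x)@_i 0 1 *: e_op i v
      + (loop x)@_i 1 0 *: f_op i v)
  + central x *: v.

Section Tensor.
Variable k : nat.

(* The k-th tensor power of F, as the free module on the k-tuples of monomials:
   << t >> is the tensor product of the basis vectors << t i >>. *)
Definition fockT := {malg K[{ffun 'I_k -> monomial}]}.

(* 1 (x) ... (x) A (x) ... (x) 1, with A at the j-th place. *)
Definition at_factor (j : 'I_k) (A : fock -> fock) : fockT -> fockT :=
  linext (fun t : {ffun 'I_k -> monomial} =>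
    linext (fun S : monomial =>
        << [ffun i => if i == j then S else t i] >> : fockT)
      (A << t j >>)).

Definition coproduct (A : fock -> fock) (v : fockT) : fockT :=
  \sum_(j < k) at_factor j A v.

Definition fockT_act (x : sl2hat) : fockT -> fockT := coproduct (fock_act x).

Definition eT (i : int) : fockT -> fockT := coproduct (e_op i).

(* With d : 'I_k.+1 -> nat, [d i] is the paper's d_(i+1), and [beta d i] is its
   beta_(i+1). *)
Definition total (d : 'I_k.+1 -> nat) : nat := (\sum_(i < k.+1) d i)%N.

Definition beta (d : 'I_k.+1 -> nat) (i : 'I_k) : nat :=
  (\sum_(j < k.+1 | i < j) d j)%N.

Definition w_vec (d : 'I_k.+1 -> nat) (s : nat) : fockT :=
  << [ffun i : 'I_k => vac (- (beta d i)%:Z - (2 * s)%N%:Z)] >>.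

(* C[e_(-(n+2s)+1), ..., e_0] w_s, i.e. all linear combinations of vectors
   e_(i_1) ... e_(i_r) w_s; the operators e_i commute. *)
Definition M_sub (d : 'I_k.+1 -> nat) (s : nat) : set fockT :=
  [set v | exists p : {malg K[seq int]},
     (forall l, l \in msupp p ->
        all (fun i : int => - (total d + 2 * s)%N%:Z + 1 <= i <= 0) l)
     /\ v = \sum_(l <- msupp p) p@_l *: foldr eT (w_vec d s) l].

Definition LD (d : 'I_k.+1 -> nat) : set fockT :=
  \bigcup_(s in [set s | (1 <= s)%N]) M_sub d s.

End Tensor.
End Fock.

(* Main.v *)
From HB Require Import structures.
Require Import Defs.
From mathcomp Require Import all_boot all_order all_algebra finmap.
From mathcomp Require Import monalg.
From mathcomp Require Import complex zify ring.
From mathcomp Require Import boolp classical_sets functions cardinality fsbigop.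
From mathcomp Require Import reals.

Set Implicit Arguments.
Unset Strict Implicit.
Unset Printing Implicit Defensive.

Import Order.TTheory GRing.Theory Num.Theory.

Local Open Scope fset_scope.
Local Open Scope classical_set_scope.
Local Open Scope ring_scope.

(** Why the limit is stable. On each factor [e(z) = psi(z) phi(z)] has square zero,
    because [psi(z)] and [phi(z)] do. Let [E(z)] be the current of the modes [eT],
    the sum of the [k] commuting factor currents. In its powers only products of
    distinct factor currents survive: [E(z)^(k+1) = 0], and [E(z)^k] is [k!] times
    the product of all of them ([sum_op_nilpotent]).

    Apply this to [w_(s+1)], a tensor product of vacua. In the lowest nonzero
    coefficient of [E(z)^k w_(s+1)] every factor receives its lowest mode that does
    not kill the vacuum, and the result is a nonzero multiple of [w_s]
    ([raised_in_words]); the modes occurring there are bounded by some [B_s] that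
    tends to minus infinity. For [b > B_s], a suitable coefficient of
    [E(z)^(k+1) w_(s+1) = 0] contains modes of index at least [b] only in the term
    [e_b w_s], which is therefore a combination of words on [w_(s+1)] with modes of
    index less than [b] ([top_mode_in_words]). By iteration, any word in the [e_i]
    on any [w_s] is, for every bound [b'] and all large [s'], a combination of words
    on [w_(s')] with modes of index at most [b'] ([words_lower]). For [b' = 0] this
    identifies [LD] with the space of all words in all the [e_i] on all the [w_s],
    which is stable under the [e_i] by its very form.

    For [f_i] and [h_i] it is enough to know, up to scalars, that
    [[e_a, f_b] = h_(a+b)] and [[h_a, e_b] = 2 e_(a+b)]; this reduces the claim to
    the vectors [f_i w_s] and [h_i w_s]. If [w_s] is written with modes of index at
    most [- i] on some [w_t] killed by [f_i], then moving [f_i] to the right leaves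
    only modes [h_j] with [j <= 0], which are scalars on [w_t] ([limit_F]). Finally
    [h_j w_s] equals [e_a f_(j-a) w_s] up to a multiple of [w_s] as soon as [e_a]
    kills [w_s] ([limit_H]).

    The two commutation relations involve infinite sums of products of four
    fermions. They follow instead from the commutators of [e_i] and [f_i] with
    single fermions, which are again single fermions, since an operator commuting
    with all the fermions is a scalar ([fermi_commutant]). *)

(** * Linear maps out of a free module *)

Section LinearExtension.
Variables (K : fieldType) (I : choiceType) (V : lmodType K).

Lemma linextEw (f : I -> V) (v : {malg K[I]}) (D : {fset I}) :
  (msupp v `<=` D)%fset -> linext f v = \sum_(x <- D) v@_x *: f x.
Proof.
move=> vD; apply: big_fset_incl => // x _ /mcoeff_outdom ->.
by rewrite scale0r.
Qed.

Lemma linext_is_linear (f : I -> V) : linear (linext f).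
Proof.
move=> a u v; pose D := (msupp u `|` msupp v `|` msupp (a *: u + v))%fset.
rewrite !(@linextEw f _ D); first last.
1-3: by apply/fsubsetP => x; rewrite !inE => ->; rewrite ?orbT.
rewrite scaler_sumr -big_split /=; apply: eq_bigr => x _.
by rewrite mcoeffD mcoeffZ scalerDl scalerA.
Qed.

HB.instance Definition _ (f : I -> V) :=
  GRing.isLinear.Build K {malg K[I]} V *:%R (linext f) (linext_is_linear f).

Lemma malgUZ (c : K) (x : I) : << c *g x >> = c *: << x >> :> {malg K[I]}.
Proof.
by apply/malgP => y; rewrite mcoeffZ !mcoeffU; case: eqP; rewrite ?mulr1 ?mulr0.
Qed.

Lemma linextU (f : I -> V) (c : K) (x : I) : linext f << c *g x >> = c *: f x.
Proof.
rewrite (@linextEw f _ [fset x]%fset) ?msuppU_le //.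
by rewrite big_seq_fset1 mcoeffUU.
Qed.

Lemma linext1 (f : I -> V) (x : I) : linext f << x >> = f x.
Proof. by rewrite linextU scale1r. Qed.

Lemma malg_ind (P : {malg K[I]} -> Prop) :
  P 0 -> (forall c x v, P v -> P (c *: << x >> + v)) -> forall v, P v.
Proof.
move=> P0 PD v; rewrite [v]monalgE; elim: (enum_fset _) => [|x s IH].
  by rewrite big_nil.
by rewrite big_cons malgUZ; apply: PD.
Qed.

Lemma eq_on_basis (A B : {malg K[I]} -> V) : linear A -> linear B ->
  (forall x, A << x >> = B << x >>) -> forall v, A v = B v.
Proof.
move=> lA lB AB; elim/malg_ind => [|c x v IH].
  have h (C : {malg K[I]} -> V) : linear C -> C 0 = 0.
    by move=> lC; have := lC (-1) 0 0; rewrite !scaleN1r oppr0 addr0 addNr.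
  by rewrite !h.
by rewrite lA lB AB IH.
Qed.

Lemma eq_linear (A B : {linear {malg K[I]} -> V}) :
  (forall x, A << x >> = B << x >>) -> A =1 B.
Proof. by apply: eq_on_basis; apply: linearP. Qed.

(** For identities between modes of currents that hold on a vector once the sums
    start low enough: how low depends on the vector. *)
Lemma eventually_linear (Q : int -> nat -> {malg K[I]} -> V) :
  (forall L n, linear (Q L n)) ->
  (forall x, exists L0, forall L, L <= L0 -> forall n, Q L n << x >> = 0) ->
  forall v, exists L0, forall L, L <= L0 -> forall n, Q L n v = 0.
Proof.
move=> Q_lin Qx; elim/malg_ind => [|c x v [L1 h1]].
  exists 0 => L _ n; have := Q_lin L n (-1) 0 0.
  by rewrite !scaleN1r oppr0 addr0 addNr.
have [L2 h2] := Qx x; exists (Num.min L1 L2) => L.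
rewrite le_min => /andP[LL1 LL2] n.
by rewrite Q_lin h1 // h2 // scaler0 addr0.
Qed.

End LinearExtension.

(** * The fermions *)

Section Fermions.
Variable K : fieldType.
Implicit Types (v : fock K) (S : monomial) (p q r : int) (b c : bool).

(** The boolean is the occupation of [p] on which the operator acts nontrivially;
    this makes creation and annihilation the two halves of one toggle. *)
Definition fermi b p : fock K -> fock K :=
  if b then @annih K p else @create K p.

#[global] Arguments fermi b p v : simpl never.

HB.instance Definition _ p := GRing.Linear.on (@create K p).
HB.instance Definition _ p := GRing.Linear.on (@annih K p).

Fact fermi_is_linear b p : linear (fermi b p).
Proof. by case: b; apply: linearP. Qed.

HB.instance Definition _ b p := GRing.isLinear.Build K (fock K) (fock K) *:%R
  (fermi b p) (fermi_is_linear b p).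

Lemma fermiU b p S : fermi b p << S >> =
  if occupied S p == b then vsign K p S *: << toggle p S >> else 0.
Proof.
rewrite -malgUZ /fermi; case: b; rewrite /create /annih linext1;
by case: (occupied S p).
Qed.

Lemma occupiedE S T : (forall q, occupied S q = occupied T q) -> S = T.
Proof.
move=> h; apply/fsetP => q; have := h q; rewrite /occupied.
by case: (q < 0); case: (q \in S); case: (q \in T).
Qed.

Lemma occupied_toggleE p q S :
  occupied (toggle p S) q = (p == q) (+) occupied S q.
Proof.
case: eqVneq => [<-|pq]; last by rewrite occupied_toggle.
by rewrite /occupied /toggle; case: ifP => pS; rewrite !inE eqxx; case: (p < 0).
Qed.

Lemma toggleC p q S : toggle p (toggle q S) = toggle q (toggle p S).
Proof. by apply: occupiedE => r; rewrite !occupied_toggleE addbCA. Qed.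

Lemma toggleK p S : toggle p (toggle p S) = S.
Proof. by apply: occupiedE => r; rewrite !occupied_toggleE addbA addbb. Qed.

Lemma vsign_toggle q p S :
  vsign K q (toggle p S) = (if q < p then -1 else 1) * vsign K q S.
Proof.
rewrite /vsign; case: ifP => qp; last first.
  rewrite mul1r; congr (_ ^+ #|` _|); apply/fsetP => r; rewrite !in_above.
  rewrite occupied_toggleE; case: eqP => [<-|//]; by rewrite qp !andbF.
have [pS|pS] := boolP (occupied S p).
  have -> : above q S = (p |` above q (toggle p S))%fset.
    apply/fsetP => r.
    rewrite in_fset1U !in_above occupied_toggleE [p == r]eq_sym.
    by case: eqVneq => [->|]; rewrite ?pS ?qp.
  rewrite cardfsU1 in_above occupied_toggleE eqxx pS /= exprD expr1.
  by rewrite mulrA mulrNN !mul1r.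
have -> : above q (toggle p S) = (p |` above q S)%fset.
  apply/fsetP => r; rewrite in_fset1U !in_above occupied_toggleE [p == r]eq_sym.
  by case: eqVneq => [->|]; rewrite ?(negbTE pS) ?qp.
by rewrite cardfsU1 in_above (negbTE pS) /= exprD expr1.
Qed.

Lemma vsign_sqr p S : vsign K p S * vsign K p S = 1.
Proof. by rewrite -expr2 sqrr_sign. Qed.

(** The canonical anticommutation relations. For distinct [p] and [q], toggling the
    larger number flips the sign attached to the smaller one and not conversely,
    so the two orders cancel. *)
Lemma CAR b p c q v : fermi b p (fermi c q v) + fermi c q (fermi b p v) =
  if (p == q) && (b != c) then v else 0.
Proof.
apply: (@eq_on_basis K _ _ (fun v => fermi b p (fermi c q v) +
  fermi c q (fermi b p v)) (fun v => if (p == q) && (b != c) then v else 0)).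
- by move=> a u w; rewrite !linearP /= addrACA scalerDr.
- by move=> a u w; case: ifP => _; rewrite ?scaler0 ?addr0.
move=> S {v}; rewrite !fermiU !(fun_if (fermi _ _)) !linearZ /=.
rewrite !linear0 !fermiU.
rewrite !occupied_toggleE.
have [<-{q}|pq] /= := eqVneq p q.
  rewrite ?eqxx !vsign_toggle ltxx !mul1r toggleK.
  case: (b); case: (c); case: (occupied S _) => //=;
  by rewrite ?scaler0 ?addr0 ?add0r ?scalerA ?vsign_sqr ?scale1r.
rewrite !vsign_toggle toggleC.
case: eqP => _; case: eqP => _; rewrite ?scaler0 ?addr0 //.
rewrite !scalerA -scalerDl.
rewrite [X in X *: _](_ : _ = 0) ?scale0r //.
by case: ltgtP pq => // _ _; ring.
Qed.

Lemma fermiC b p c q v : ~~ ((p == q) && (b != c)) ->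
  fermi b p (fermi c q v) = - fermi c q (fermi b p v).
Proof. by move=> /negbTE h; apply/eqP; rewrite -addr_eq0 CAR h. Qed.

End Fermions.

(** * The currents as quadratic expressions in the fermions *)

Section Quadratic.
Variables (K : fieldType) (b : bool) (X Y : int -> int).
Implicit Types (v : fock K) (a r : int) (D : {fset int}).

Let term a v : fock K := fermi b (X a) (fermi b (Y a) v).

Definition quad v : fock K := \sum_(a \in [set: int]) term a v.

Hypothesis term_finite : forall v, finite_set [set a | term a v != 0].

Let supp v : {fset int} := fset_set [set a | term a v != 0].

Lemma quadE D v : (supp v `<=` D)%fset -> quad v = \sum_(a <- D) term a v.
Proof.
move=> vD; rewrite /quad (fsbigTE D) // => a aD.
apply/eqP/negPn/negP => ta; move/negP: aD; apply.
by apply: (fsubsetP vD); rewrite in_fset_set ?inE.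
Qed.

Lemma quad_is_linear : linear quad.
Proof.
move=> c u v; pose D := (supp u `|` supp v `|` supp (c *: u + v)%R)%fset.
rewrite !(@quadE D).
2-4: by rewrite /D; apply/fsubsetP => x xs; rewrite !in_fsetU xs ?orbT.
rewrite scaler_sumr -big_split /=; apply: eq_bigr => a _.
by rewrite /term !linearP.
Qed.

Hypotheses (X_inj : injective X) (Y_inj : injective Y).
Hypothesis XY : forall a a', X a != Y a'.

(* Only the summand of index [a0] fails to commute with the fermion. *)
Let quad_comm r (c : bool) v (R : int -> fock K) a0 :
  (forall a, term a (fermi c r v) =
     fermi c r (term a v) + if a == a0 then R a else 0) ->
  quad (fermi c r v) = fermi c r (quad v) + R a0.
Proof.
move=> h; pose D := (supp v `|` supp (fermi c r v) `|` [fset a0])%fset.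
rewrite !(@quadE D).
2-3: by rewrite /D; apply/fsubsetP => x xs; rewrite !in_fsetU xs ?orbT.
under eq_bigr do rewrite h.
rewrite big_split /= -linear_sum; congr (_ + _).
have a0D : a0 \in D by rewrite !in_fsetU in_fset1 eqxx orbT.
rewrite (big_fsetD1 a0) //= eqxx big_seq big1 ?addr0 // => a.
by rewrite in_fsetD1 => /andP[/negbTE ->].
Qed.

Lemma quad_fermi_same r v : quad (fermi b r v) = fermi b r (quad v).
Proof.
rewrite (@quad_comm r b v (fun=> 0) 0) ?addr0 // => a; rewrite if_same addr0.
have h p w : fermi b p (fermi b r w) = - fermi b r (fermi b p w).
  by rewrite fermiC // eqxx andbF.
by rewrite /term h raddfN /= h opprK.
Qed.

Lemma quad_fermi_left a0 v : quad (fermi (~~ b) (X a0) v) =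
  fermi (~~ b) (X a0) (quad v) - fermi b (Y a0) v.
Proof.
rewrite (@quad_comm _ _ v (fun a => - fermi b (Y a) v) a0) // => a.
rewrite /term (fermiC (p := Y a)); last by rewrite eq_sym negb_and XY.
rewrite linearN /=; have := CAR b (X a) (~~ b) (X a0) (fermi b (Y a) v).
rewrite (inj_eq X_inj) [b != _](_ : _ = true) ?andbT; last by case: (b).
by move/(canRL (addrK _)) ->; rewrite opprB; case: eqP => _; rewrite ?oppr0.
Qed.

Lemma quad_fermi_right a0 v : quad (fermi (~~ b) (Y a0) v) =
  fermi (~~ b) (Y a0) (quad v) + fermi b (X a0) v.
Proof.
rewrite (@quad_comm _ _ v (fun a => fermi b (X a) v) a0) // => a.
have := CAR b (Y a) (~~ b) (Y a0) v.
rewrite (inj_eq Y_inj) [b != _](_ : _ = true) ?andbT; last by case: (b).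
rewrite /term => /(canRL (addrK _)) ->; rewrite linearB /=.
rewrite (fermiC (q := Y a0)); last by rewrite negb_and XY.
by rewrite opprK addrC; case: eqP => _; rewrite ?linear0.
Qed.

(** Two anticommuting factors kill a vector as soon as one of them does. *)
Lemma quad_eq0 v : (forall a, fermi b (X a) v = 0 \/ fermi b (Y a) v = 0) ->
  quad v = 0.
Proof.
move=> h; apply: fsbig1 => a _; rewrite /term; case: (h a) => ha.
  by rewrite fermiC ?eqxx ?andbF // ha linear0 oppr0.
by rewrite ha linear0.
Qed.

End Quadratic.

Section Currents.
Variable K : fieldType.
Implicit Types (v : fock K) (S : monomial) (a i j p q r m : int) (b : bool).

(** The variables psi have even numbers and the variables phi odd ones; this sign
    tells them apart, so that one formula covers both. *)
Definition alt r : K := (-1) ^+ `|r|%N.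

Lemma int_parity r : exists t, r = 2 * t \/ r = 2 * t + 1.
Proof. by exists (r %/ 2)%Z; lia. Qed.

Lemma alt_even t : alt (2 * t) = 1.
Proof. by rewrite /alt -signr_odd (_ : odd _ = false) //; lia. Qed.

Lemma alt_odd t : alt (2 * t + 1) = -1.
Proof. by rewrite /alt -signr_odd (_ : odd _ = true) //; lia. Qed.

Lemma alt_mate i r : alt (2 * i + 1 - r) = - alt r.
Proof.
have [t [->|->]] := int_parity r.
  by rewrite (_ : _ - _ = 2 * (i - t) + 1) ?alt_odd ?alt_even //; lia.
by rewrite (_ : _ - _ = 2 * (i - t)) ?alt_odd ?alt_even ?opprK //; lia.
Qed.

Lemma alt_sqr r : alt r * alt r = 1.
Proof. by rewrite -expr2 sqrr_sign. Qed.

Let eX a : int := 2 * a.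
Let eY i a : int := 2 * (i - a) + 1.
Let fX a : int := 2 * - a + 1.
Let fY i a : int := 2 * - (i - a).

Lemma e_opE i v : e_op i v = quad false eX (eY i) v.
Proof. by []. Qed.

Lemma f_opE i v : f_op i v = quad true fX (fY i) v.
Proof. by []. Qed.

Lemma e_op_sum i (s : seq int) v : uniq s ->
  (forall a, a \notin s ->
     fermi false (2 * a) (fermi false (2 * (i - a) + 1) v) = 0) ->
  e_op i v =
    \sum_(a <- s) fermi false (2 * a) (fermi false (2 * (i - a) + 1) v).
Proof.
move=> s_uniq h; rewrite /e_op (fsbigTE [fset x in s]%fset) => [|a]; last first.
  by rewrite in_fset => /h.
apply: perm_big; apply: uniq_perm; rewrite ?fset_uniq // => a.
by rewrite in_fset.
Qed.

Let e_finite i v :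
  finite_set [set a | fermi false (eX a) (fermi false (eY i a) v) != 0] :=
  e_op_finite i v.

Let f_finite i v :
  finite_set [set a | fermi true (fX a) (fermi true (fY i a) v) != 0] :=
  f_op_finite i v.

Fact e_op_is_linear i : linear (@e_op K i).
Proof. exact: (@quad_is_linear K false eX (eY i) (e_finite i)). Qed.

Fact f_op_is_linear i : linear (@f_op K i).
Proof. exact: (@quad_is_linear K true fX (fY i) (f_finite i)). Qed.

HB.instance Definition _ i := GRing.isLinear.Build K (fock K) (fock K) *:%R
  (@e_op K i) (e_op_is_linear i).
HB.instance Definition _ i := GRing.isLinear.Build K (fock K) (fock K) *:%R
  (@f_op K i) (f_op_is_linear i).

Let eX_inj : injective eX. Proof. by rewrite /eX => ? ?; lia. Qed.
Let eY_inj i : injective (eY i). Proof. by rewrite /eY => ? ?; lia. Qed.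
Let eXY i a a' : eX a != eY i a'. Proof. by rewrite /eX /eY; lia. Qed.
Let fX_inj : injective fX. Proof. by rewrite /fX => ? ?; lia. Qed.
Let fY_inj i : injective (fY i). Proof. by rewrite /fY => ? ?; lia. Qed.
Let fXY i a a' : fX a != fY i a'. Proof. by rewrite /fX /fY; lia. Qed.

Lemma e_create i r v : e_op i (fermi false r v) = fermi false r (e_op i v).
Proof. exact: (quad_fermi_same (e_finite i)). Qed.

Lemma e_annih i r v : e_op i (fermi true r v) =
  fermi true r (e_op i v) - alt r *: fermi false (2 * i + 1 - r) v.
Proof.
have [t [->|->]] := int_parity r.
  have := quad_fermi_left (e_finite i) eX_inj (@eXY i) t v.
  rewrite -e_opE /= /eX /eY alt_even scale1r => ->.
  by congr (_ - fermi _ _ v); lia.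
have := quad_fermi_right (e_finite i) (@eY_inj i) (@eXY i) (i - t) v.
rewrite -e_opE /= /eX /eY alt_odd scaleN1r opprK.
rewrite (_ : i - (i - t) = t) => [->|]; last lia.
by congr (_ + fermi _ _ v); lia.
Qed.

Lemma f_annih i r v : f_op i (fermi true r v) = fermi true r (f_op i v).
Proof. exact: (quad_fermi_same (f_finite i)). Qed.

Lemma f_create i r v : f_op i (fermi false r v) =
  fermi false r (f_op i v) + alt r *: fermi true (1 - 2 * i - r) v.
Proof.
have [t [->|->]] := int_parity r.
  have := quad_fermi_right (f_finite i) (@fY_inj i) (@fXY i) (i + t) v.
  rewrite -f_opE /= /fX /fY alt_even scale1r.
  rewrite (_ : - (i - (i + t)) = t) => [->|]; last lia.
  by congr (_ + fermi _ _ v); lia.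
have := quad_fermi_left (f_finite i) fX_inj (@fXY i) (- t) v.
rewrite -f_opE /= /fX /fY alt_odd scaleN1r opprK => ->.
by congr (_ - fermi _ _ v); lia.
Qed.

(** The composite is a projection: it counts whether [p] has occupation [b]. *)
Lemma mcoeff_number b p v S :
  (fermi (~~ b) p (fermi b p v))@_S = if occupied S p == b then v@_S else 0.
Proof.
elim/malg_ind: v => [|c T v IH].
  by rewrite !linear0 mcoeff0 if_same.
rewrite !linearP /= !mcoeffD !mcoeffZ IH fermiU.
have -> : (fermi (~~ b) p
    (if occupied T p == b then vsign K p T *: << toggle p T >> else 0))@_S =
  if occupied S p == b then << T >>@_S else 0 :> K.
  rewrite !mcoeffU; case: eqP => Tb.
    rewrite linearZ /= fermiU occupied_toggleE eqxx /= Tb eqxx.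
    rewrite vsign_toggle ltxx mul1r toggleK scalerA vsign_sqr scale1r mcoeffU.
    by case: (eqVneq T S) => [<-|]; rewrite ?Tb ?eqxx ?if_same.
  rewrite linear0 mcoeff0; case: (eqVneq T S) => [<-|]; rewrite ?if_same //.
  by case: eqP Tb.
by case: ifP => _; rewrite ?mulr0 ?addr0.
Qed.

(** Schur's lemma for the fermions: such an operator maps the vacuum to a vector
    killed by the same fermions, hence to a multiple of it, and the fermions
    reach every monomial from the vacuum. *)
Lemma fermi_commutant (T : fock K -> fock K) : linear T ->
  (forall b p v, T (fermi b p v) = fermi b p (T v)) ->
  exists c, forall v, T v = c *: v.
Proof.
(* The empty symmetric difference encodes the vacuum of all negative numbers. *)
move=> T_lin Tfermi; pose S0 : monomial := fset0; pose x := T << S0 >>.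
have S0E q : occupied S0 q = (q < 0) by rewrite /occupied inE addbF.
have T0 : T 0 = 0.
  by have := T_lin (-1) 0 0; rewrite !scaleN1r oppr0 addr0 addNr.
have TZ c v : T (c *: v) = c *: T v by rewrite -[c *: v]addr0 T_lin T0 addr0.
have xE : x = x@_S0 *: << S0 >>.
  apply/malgP => S; rewrite mcoeffZ mcoeffU.
  case: eqVneq => [<-|S0S]; first by rewrite mulr1.
  rewrite mulr0; apply/eqP/negPn/negP => xS; move/negP: S0S; apply; apply/eqP.
  apply: occupiedE => p; rewrite S0E.
  have := mcoeff_number (p >= 0) p x S; rewrite /x -Tfermi fermiU S0E.
  rewrite ltNge [_ == _](_ : _ = false); last by case: (0 <= p).
  rewrite T0 linear0 mcoeff0; case: eqP => [_ /esym/eqP|].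
    by rewrite (negbTE xS).
  by case: (0 <= p); case: (occupied S p).
exists x@_S0; apply: (eq_on_basis T_lin) => [a u v|].
  by rewrite scalerDr !scalerA mulrC.
elim/finSet_rect => S IH.
have [->|[p pS]] := fset_0Vmem S; first by rewrite -xE.
pose S' := toggle p S; pose b := occupied S' p.
have -> : << S >> = vsign K p S' *: fermi b p << S' >> :> fock K.
  by rewrite fermiU eqxx scalerA vsign_sqr scale1r toggleK.
rewrite TZ Tfermi IH ?linearZ /=; first by rewrite scalerA mulrC -scalerA.
by rewrite /S' /toggle pS fproperD1.
Qed.

End Currents.

(** * The current algebra, up to scalars *)

Section Commutator.
Variables (K : pzRingType) (V : lmodType K).

Definition commutator (A B : V -> V) (v : V) : V := A (B v) - B (A v).

Fact commutator_is_linear (A B : {linear V -> V}) : linear (commutator A B).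
Proof.
by move=> a u v; rewrite /commutator !linearP /= addrACA -scalerDr.
Qed.

HB.instance Definition _ (A B : {linear V -> V}) :=
  GRing.isLinear.Build K V V *:%R (commutator A B) (commutator_is_linear A B).

Lemma commutatorE (A B : V -> V) v : A (B v) = B (A v) + commutator A B v.
Proof. by rewrite addrC subrK. Qed.

Lemma commutator_eqr (A B C : V -> V) :
  B =1 C -> commutator A B =1 commutator A C.
Proof. by move=> BC v; rewrite /commutator !BC. Qed.

Lemma commutatorZr (A : {linear V -> V}) (x : K) (B : V -> V) v :
  commutator A (x \*: B) v = x *: commutator A B v.
Proof. by rewrite /commutator /= linearZ scalerBr. Qed.

Lemma jacobi (A B C : {linear V -> V}) v :
  commutator (commutator A B) C v =
  commutator A (commutator B C) v - commutator B (commutator A C) v.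
Proof.
have alg (abc bac cab cba acb bca : V) : (abc - bac) - (cab - cba) =
    ((abc - acb) - (bca - cba)) - ((bac - bca) - (acb - cab)).
  by rewrite !opprB [RHS]addrACA !addrA !subrK [LHS](ACl (1*4*3*2)).
by rewrite /commutator (raddfB A) (raddfB B) (raddfB C); exact: alg.
Qed.

End Commutator.

Section FermionicCommutators.
Variables (K : numFieldType) (V : lmodType K).
Variable fermi : bool -> int -> {linear V -> V}.
Variables e f : int -> {linear V -> V}.
Variable alt : int -> K.
Implicit Types (v : V) (a c i j p q r m : int) (b : bool).

Hypothesis alt_mate : forall i r, alt (2 * i + 1 - r) = - alt r.
Hypothesis alt_sqr : forall r, alt r * alt r = 1.
Hypothesis e_create : forall i r v,
  e i (fermi false r v) = fermi false r (e i v).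
Hypothesis e_annih : forall i r v, e i (fermi true r v) =
  fermi true r (e i v) - alt r *: fermi false (2 * i + 1 - r) v.
Hypothesis f_annih : forall i r v, f i (fermi true r v) = fermi true r (f i v).
Hypothesis f_create : forall i r v, f i (fermi false r v) =
  fermi false r (f i v) + alt r *: fermi true (1 - 2 * i - r) v.
Hypothesis fermi_commutant : forall T : {linear V -> V},
  (forall b p v, T (fermi b p v) = fermi b p (T v)) ->
  exists x, forall v, T v = x *: v.

Lemma e_comm_create i r v : commutator (e i) (fermi false r) v = 0.
Proof. by rewrite /commutator e_create subrr. Qed.

Lemma e_comm_annih i r v : commutator (e i) (fermi true r) v =
  (- alt r) *: fermi false (2 * i + 1 - r) v.
Proof. by rewrite /commutator e_annih addrAC subrr sub0r scaleNr. Qed.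

Lemma f_comm_create i r v : commutator (f i) (fermi false r) v =
  alt r *: fermi true (1 - 2 * i - r) v.
Proof. by rewrite /commutator f_create addrAC subrr add0r. Qed.

Lemma f_comm_annih i r v : commutator (f i) (fermi true r) v = 0.
Proof. by rewrite /commutator f_annih subrr. Qed.

Lemma comm_commutant (T : {linear V -> V}) :
  (forall b p v, commutator T (fermi b p) v = 0) ->
  exists x : K, forall v, T v = x *: v.
Proof.
move=> h; apply: fermi_commutant => b p v.
by rewrite commutatorE h addr0.
Qed.

(** The commutator of [e i] with a fermion is a multiple of a creation operator,
    with which all the [e j] commute, so the iterated commutators vanish. *)
Lemma ee_comm_scalar i j :
  exists x : K, forall v, e i (e j v) - e j (e i v) = x *: v.
Proof.
have [|x Tx] := @comm_commutant (commutator (e i) (e j)); last by exists x.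
have ee k l b p w : commutator (e k) (commutator (e l) (fermi b p)) w = 0.
  case: b; last first.
    rewrite (commutator_eqr _ (C := 0 \*: fermi false p)).
      by rewrite commutatorZr scale0r.
    by move=> u; rewrite e_comm_create /= scale0r.
  rewrite (commutator_eqr _ (e_comm_annih l p)) commutatorZr.
  by rewrite e_comm_create scaler0.
by move=> b p w; rewrite jacobi !ee subrr.
Qed.

Lemma ef_comm_create a c r v :
  commutator (commutator (e a) (f c)) (fermi false r) v =
  fermi false (r + 2 * (a + c)) v.
Proof.
rewrite jacobi (commutator_eqr _ (f_comm_create c r)) commutatorZr e_comm_annih.
rewrite (commutator_eqr _ (C := 0 \*: fermi false r)) ?commutatorZr; last first.
  by move=> u; rewrite e_comm_create /= scale0r.
rewrite scale0r subr0 (_ : 1 - 2 * c - r = 2 * (- c) + 1 - r); last lia.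
rewrite alt_mate opprK scalerA alt_sqr scale1r; congr (fermi _ _ v); lia.
Qed.

Lemma ef_comm_annih a c r v :
  commutator (commutator (e a) (f c)) (fermi true r) v =
  - fermi true (r - 2 * (a + c)) v.
Proof.
rewrite jacobi (commutator_eqr _ (e_comm_annih a r)) commutatorZr f_comm_create.
rewrite (commutator_eqr _ (C := 0 \*: fermi true r)) ?commutatorZr; last first.
  by move=> u; rewrite f_comm_annih /= scale0r.
rewrite scale0r sub0r alt_mate scalerA mulrNN alt_sqr scale1r.
congr (- fermi _ _ v); lia.
Qed.

(** The diagonal part of the current algebra, up to scalars: both sides have the
    same commutators with all the fermions. *)
Lemma ef_comm_scalar a c a' c' : a + c = a' + c' -> exists x : K, forall v,
  commutator (e a) (f c) v = commutator (e a') (f c') v + x *: v.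
Proof.
move=> ac.
have [|x Tx] := @comm_commutant
  (commutator (e a) (f c) \- commutator (e a') (f c')).
  move=> b p v.
  have -> (A B C : {linear V -> V}) :
      commutator (A \- B) C v = commutator A C v - commutator B C v.
    by rewrite /commutator /= raddfB !opprB [RHS](AC (2*2) ((1*4)*(3*2))).
  by case: b; rewrite ?ef_comm_annih ?ef_comm_create ac subrr.
by exists x => v; rewrite -Tx /= addrC subrK.
Qed.

(** Again both sides have the same commutators with all the fermions. *)
Lemma he_comm_scalar a c i : exists x : K, forall v,
  commutator (commutator (e a) (f c)) (e i) v =
  2 *: e (a + c + i) v + x *: v.
Proof.
pose h : {linear V -> V} := commutator (e a) (f c).
have [|x Tx] := @comm_commutant (commutator h (e i) \- (2 \*: e (a + c + i))).
  move=> b p v.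
  have -> (A B C : {linear V -> V}) :
      commutator (A \- 2 \*: B) C v = commutator A C v - 2 *: commutator B C v.
    rewrite /commutator /= (raddfB C) /= (linearZZ C) scalerBr !opprB.
    by rewrite [RHS](AC (2*2) ((1*4)*(3*2))).
  rewrite jacobi; case: b.
    rewrite (commutator_eqr _ (e_comm_annih i p)) commutatorZr ef_comm_create.
    rewrite (commutator_eqr _ (C := (-1) \*: fermi true (p - 2 * (a + c)))).
      rewrite commutatorZr !e_comm_annih scaleN1r !scaleNr !scalerN !opprK.
      have -> : p - 2 * (a + c) = 2 * 0 + 1 - (2 * (a + c) + 1 - p) by lia.
      rewrite !alt_mate opprK; set r := 2 * i + 1 - (_ - _).
      rewrite (_ : 2 * i + 1 - p + 2 * (a + c) = r); last by rewrite /r; lia.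
      rewrite (_ : 2 * (a + c + i) + 1 - p = r); last by rewrite /r; lia.
      by rewrite scaler_nat mulr2n -opprD addNr.
    by move=> u; rewrite ef_comm_annih /= scaleN1r.
  rewrite (commutator_eqr _ (C := 0 \*: fermi false p)) ?commutatorZr; last first.
    by move=> u; rewrite e_comm_create /= scale0r.
  rewrite (commutator_eqr _ (ef_comm_create a c p)) !e_comm_create.
  by rewrite scale0r scaler0 !subr0.
by exists x => v; rewrite -Tx /= addrC subrK.
Qed.

End FermionicCommutators.

Section Relations.
Variable K : numFieldType.
Implicit Types (v : fock K) (S : monomial) (a c i j p q r m : int) (b : bool).

Lemma e_vac i m : i <= m -> e_op i << vac m >> = 0 :> fock K.
Proof.
(* The numbers of the two variables add up to [2 * i + 1]. *)
move=> im; rewrite e_opE; apply: quad_eq0 => a; rewrite !fermiU !occupied_vac.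
have [am|am] := leP (2 * a) m; [by left | right].
by rewrite (_ : _ <= m); last lia.
Qed.

Lemma f_vac i m : i <= - m -> f_op i << vac m >> = 0 :> fock K.
Proof.
(* The numbers of the two variables are distinct and add up to [1 - 2 * i]. *)
move=> im; rewrite f_opE; apply: quad_eq0 => a; rewrite !fermiU !occupied_vac.
have [am|am] := leP (2 * - a + 1) m; [right | by left].
by rewrite (_ : _ <= m = false) //; lia.
Qed.

(** The lowest mode that acts on a vacuum fills the two lowest free variables
    [m + 1] and [m + 2], one of which is a psi and the other a phi. *)
Lemma e_vac_next m : exists2 eps : K, eps != 0 &
  e_op (m + 1) << vac m >> = eps *: << vac (m + 2) >> :> fock K.
Proof.
have [t mt] : exists t, m = 2 * t \/ m = 2 * t + 1 by exact: int_parity.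
pose Y a := 2 * (m + 1 - a) + 1.
have kill a : a != t + 1 ->
    fermi false (2 * a) (fermi false (Y a) << vac m >>) = 0 :> fock K.
  move=> at1; rewrite !fermiU !occupied_vac /Y.
  have [am|am] := leP (2 * (m + 1 - a) + 1) m; first by rewrite linear0.
  rewrite linearZ /= fermiU occupied_toggleE occupied_vac.
  rewrite [_ == _ :> int](_ : _ = false); last lia.
  by rewrite (_ : _ <= m) /= ?scaler0 //; lia.
rewrite (@e_op_sum _ _ [:: t + 1]) => [|//|a]; last by rewrite inE => /kill.
rewrite big_seq1 !fermiU occupied_vac.
rewrite (_ : _ <= m = false) /=; last lia.
rewrite linearZ /= fermiU occupied_toggleE occupied_vac.
rewrite [_ == _ :> int](_ : _ = false); last lia.
rewrite (_ : _ <= m = false) /=; last lia.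
rewrite scalerA; eexists; last first.
  congr (_ *: << _ >>); apply: occupiedE => q.
  by rewrite !occupied_toggleE !occupied_vac; lia.
by rewrite mulf_neq0 ?signr_eq0.
Qed.

Let commutant (T : {linear fock K -> fock K}) :
  (forall b p v, T (fermi b p v) = fermi b p (T v)) ->
  exists x : K, forall v, T v = x *: v.
Proof. by move=> h; apply: fermi_commutant => //; apply: linearP. Qed.

(** The scalar is zero because both operators kill the vacuum at a high level. *)
Lemma e_op_comm i j v : e_op i (e_op j v) = e_op j (e_op i v).
Proof.
have [x Tx] := @ee_comm_scalar K (fock K) (fermi (K := K)) (e_op (K := K))
  (alt K) (@e_create K) (@e_annih K) commutant i j.
apply/eqP; rewrite -subr_eq0 Tx; pose m := `|i| + `|j|.
have /eqP := Tx << vac m >>.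
rewrite /= !e_vac; try lia.
rewrite !linear0 addr0 eq_sym scaler_eq0 => /orP[/eqP ->|].
  by rewrite scale0r.
by rewrite monalgU_eq0 oner_eq0.
Qed.

Lemma ef_op_comm a c : exists x : K, forall v,
  commutator (@e_op K a) (@f_op K c) v = h_op (a + c) v + x *: v.
Proof.
have := @ef_comm_scalar K (fock K) (fermi (K := K)) (e_op (K := K))
  (f_op (K := K)) (alt K) (@alt_mate K) (@alt_sqr K) (@e_create K) (@e_annih K)
  (@f_annih K) (@f_create K) commutant a c 0 (a + c).
by apply; rewrite add0r.
Qed.

Lemma he_op_comm j i : exists x : K, forall v,
  commutator (@h_op K j) (@e_op K i) v = 2 *: e_op (j + i) v + x *: v.
Proof.
have := @he_comm_scalar K (fock K) (fermi (K := K)) (e_op (K := K))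
  (f_op (K := K)) (alt K) (@alt_mate K) (@alt_sqr K) (@e_create K) (@e_annih K)
  (@f_annih K) (@f_create K) commutant 0 j i.
by rewrite add0r.
Qed.

(** [h_op j] is a scalar plus the commutator of [e_op m] and [f_op (j - m)], and
    both of these kill the vacuum. *)
Lemma h_vac j m : j <= 0 ->
  exists x : K, h_op j << vac m >> = x *: << vac m >> :> fock K.
Proof.
move=> j0; have [x] := ef_op_comm m (j - m); move/(_ << vac m >>).
rewrite /commutator e_vac // f_vac; last lia.
rewrite !raddf0 addr0 (_ : m + (j - m) = j) => [/esym/eqP|]; last lia.
 rewrite addr_eq0 -scaleNr => /eqP ->.
by exists (- x).
Qed.

End Relations.

(** * Formal series of operators acting on formal series of vectors *)

Section Convolution.
Variables (K : numFieldType) (V : lmodType K).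
Implicit Types (a b c : nat -> {linear V -> V}) (X : nat -> V).

(** The coefficients of the product [a(z) X(z)]. *)
Definition conv (a : nat -> V -> V) (X : nat -> V) (n : nat) : V :=
  \sum_(i < n.+1) a i (X (n - i)%N).

Definition delta (v : V) (n : nat) : V := if n == 0%N then v else 0.

Lemma conv_delta a v n : conv a (delta v) n = a n v.
Proof.
rewrite /conv big_ord_recr /= subnn big1 ?add0r // => i _.
by rewrite /delta subn_eq0 leqNgt ltn_ord linear0.
Qed.

Lemma convD a X Y n : conv a (X \+ Y) n = conv a X n + conv a Y n.
Proof. by rewrite -big_split; apply: eq_bigr => i _ /=; rewrite linearD. Qed.

Lemma conv2E a b X n : conv a (conv b X) n =
  \sum_(i < n.+1) \sum_(j < n.+1 | (i + j <= n)%N)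
    a i (b j (X (n - (i + j))%N)).
Proof.
apply: eq_bigr => i _; rewrite /conv linear_sum.
rewrite (big_ord_widen n.+1 (fun j => a i (b j (X (n - i - j)%N)))); last first.
  by rewrite ltnS leq_subr.
apply: eq_big => [j|j _]; last by rewrite subnDA.
by rewrite ltnS; have := ltn_ord i; lia.
Qed.

(** [c] is [a] for commuting series and [- a] for anticommuting ones. *)
Lemma conv_swap a b c X : (forall i j v, a i (b j v) = b j (c i v)) ->
  conv a (conv b X) = conv b (conv c X).
Proof.
move=> abc; apply/funext => n; rewrite !conv2E.
rewrite (exchange_big_dep xpredT) //=; apply: eq_bigr => j _.
by apply: eq_big => [i|i _]; rewrite addnC // abc.
Qed.

Lemma conv_conv a b X n : conv a (conv b X) n =
  \sum_(l < n.+1) \sum_(i < l.+1) a i (b (l - i)%N (X (n - l)%N)).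
Proof.
rewrite conv2E.
pose F i l := a i (b (l - i)%N (X (n - l)%N)).
transitivity (\sum_(i < n.+1) \sum_(l < n.+1 | (i <= l)%N) F i l).
  apply: eq_bigr => i _.
  rewrite -(big_mkord (fun j => (i + j <= n)%N)
              (fun j => a i (b j (X (n - (i + j))%N)))).
  rewrite -(big_mkord (fun l => (i <= l)%N) (fun l => F i l)).
  have i_n : (i <= n.+1)%N by apply: ltnW.
  rewrite [RHS](big_cat_nat (n := i)) //= [X in X + _]big_nat_cond.
  rewrite [X in X + _]big1 ?add0r => [|l]; last first.
    by rewrite leq0n /= ltnNge => /andP[/negbTE ->].
  have -> : \sum_(i <= l < n.+1 | (i <= l)%N) F i l =
      \sum_(0 <= l < n.+1 - i | (i <= l + i)%N) F i (l + i)%N.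
    by rewrite -{1}[nat_of_ord i]add0n big_addn.
  rewrite [LHS](big_cat_nat (n := (n.+1 - i)%N)) ?leq_subr //=.
  rewrite [X in _ + X]big_nat_cond [X in _ + X]big1 ?addr0 => [|l]; last first.
    by move=> /andP[/andP[h _] h2]; exfalso; lia.
  rewrite big_nat_cond [RHS]big_nat_cond; apply: eq_big => [l|l _].
    by case: (ltnP l (n.+1 - i)) => h; rewrite /= ?andbF //; lia.
  by rewrite /F addnK addnC.
rewrite (exchange_big_dep xpredT) //=; apply: eq_bigr => l _.
rewrite (big_ord_widen n.+1 (fun i => F i l)) ?ltnS ?leq_ord //.
Qed.

Lemma oppr_fix (v : V) : v = - v -> v = 0.
Proof.
move/eqP; rewrite -addr_eq0 -mulr2n -scaler_nat scaler_eq0 pnatr_eq0 /=.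
by move/eqP.
Qed.

Lemma conv_anti_sq a X : (forall i j v, a i (a j v) = - a j (a i v)) ->
  conv a (conv a X) = \0.
Proof.
move=> aa; apply/funext => n; apply: oppr_fix.
rewrite {1}(conv_swap (c := fun i => \- a i)); last first.
  by move=> i j v; rewrite aa linearN.
rewrite {1}/conv -sumrN; apply: eq_bigr => i _.
by rewrite -linearN -sumrN.
Qed.

End Convolution.

Section Square.
Variables (K : numFieldType) (V : lmodType K).
Variables (psi phi e : int -> {linear V -> V}) (A B : int).

Hypothesis psi_psi : forall i j v, psi i (psi j v) = - psi j (psi i v).
Hypothesis phi_phi : forall i j v, phi i (phi j v) = - phi j (phi i v).
Hypothesis phi_psi : forall i j v, phi i (psi j v) = - psi j (phi i v).

Let good v :=
  (forall i, i < A -> psi i v = 0) /\ (forall i, i < B -> phi i v = 0).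

Hypothesis e_sum : forall v n, good v -> e (A + B + n%:Z) v =
  \sum_(i < n.+1) psi (A + i%:Z) (phi (B + (n - i)%N%:Z) v).

Let good_psi j v : good v -> good (psi j v).
Proof.
by case=> h1 h2; split=> i Hi; [rewrite psi_psi h1 | rewrite phi_psi h2];
   rewrite // linear0 oppr0.
Qed.

Let good_phi j v : good v -> good (phi j v).
Proof.
case=> h1 h2; split=> i Hi; last by rewrite phi_phi h2 // linear0 oppr0.
by apply: oppr_inj; rewrite -phi_psi h1 // linear0 oppr0.
Qed.

Let good_sum n (F : 'I_n -> V) : (forall i, good (F i)) -> good (\sum_i F i).
Proof.
move=> h; split=> i Hi; rewrite linear_sum big1 // => l _.
  exact: (h l).1.
exact: (h l).2.
Qed.

Let conv_e X : (forall n, good (X n)) ->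
  conv (fun i => e (A + B + i%:Z)) X =
  conv (fun i => psi (A + i%:Z)) (conv (fun i => phi (B + i%:Z)) X).
Proof.
move=> gX; apply/funext => n; rewrite conv_conv; apply: eq_bigr => l _.
by rewrite e_sum.
Qed.

(** The current [psi(z) phi(z)] has square zero, as [psi(z)] and [phi(z)] do. *)
Lemma current_sqr0 v n : good v ->
  \sum_(i < n.+1) e (A + B + i%:Z) (e (A + B + (n - i)%N%:Z) v) = 0.
Proof.
move=> gv; have g0 : good 0 by split=> i _; rewrite linear0.
have gd m : good (delta v m) by rewrite /delta; case: ifP.
pose P i := psi (A + i%:Z); pose Q i := phi (B + i%:Z).
transitivity (conv (fun i => e (A + B + i%:Z))
                (conv (fun i => e (A + B + i%:Z)) (delta v)) n).
  by apply: eq_bigr => i _; rewrite conv_delta.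
have gPQ m : good (conv P (conv Q (delta v)) m).
  by apply: good_sum => i; apply/good_psi/good_sum => l; apply: good_phi.
rewrite conv_e // conv_e // -/P -/Q.
rewrite [conv Q (conv P _)](conv_swap (c := fun i => \- Q i)); last first.
  by move=> i j u; rewrite phi_psi linearN.
by rewrite (conv_anti_sq (a := P)) // => i j u; apply: psi_psi.
Qed.

End Square.

(** * The square of e(z) vanishes *)

Section FockSquare.
Variable K : numFieldType.
Implicit Types (v : fock K) (i j a L A B : int) (n : nat).

Let psi_ a : {linear fock K -> fock K} := fermi false (2 * a).
Let phi_ a : {linear fock K -> fock K} := fermi false (2 * a + 1).

Lemma e_op_window A B v n :
  (forall i, i < A -> fermi false (2 * i) v = 0) ->
  (forall i, i < B -> fermi false (2 * i + 1) v = 0) ->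
  e_op (A + B + n%:Z) v = \sum_(i < n.+1)
    fermi false (2 * (A + i%:Z)) (fermi false (2 * (B + (n - i)%N%:Z) + 1) v).
Proof.
move=> psi0 phi0.
rewrite (@e_op_sum _ _ [seq A + Posz m | m <- index_iota 0 n.+1]).
- rewrite big_map big_mkord; apply: eq_bigr => i _.
  have i_n := ltn_ord i.
  by rewrite (_ : A + B + n%:Z - (A + i%:Z) = B + (n - i)%N%:Z) //; lia.
- by rewrite map_inj_uniq ?iota_uniq // => i j; lia.
move=> a aD; have [aA|Aa] := ltP a A.
  by rewrite fermiC ?andbF // psi0 // linear0 oppr0.
rewrite phi0 ?linear0 //; apply: contraNlt aD => h.
apply/mapP; exists `|a - A|%N; last lia.
by rewrite mem_index_iota; lia.
Qed.

(** The current [e(z)] has square zero; the sums are cut off below at a mode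
    under which nothing acts on [v]. *)
Lemma e_op_sqr0 v : exists L0, forall L, L <= L0 -> forall n,
  \sum_(i < n.+1) e_op (L + i%:Z) (e_op (L + (n - i)%N%:Z) v) = 0.
Proof.
have [B hB] := occupied_bound v; pose A := - `|B| - 1.
have low p : p <= A -> fermi false p v = 0.
  by move=> pA; apply: create_eq0 => S /hB Sv; apply: (Sv p).1; lia.
(* All variables of number at most [A] are occupied throughout [v], so neither
   [psi_ i] nor [phi_ i] acts on [v] when [2 * i + 1 <= A]. *)
exists (2 * A) => L LA n; rewrite (_ : L = A + (L - A)); last lia.
apply: (@current_sqr0 K (fock K) psi_ phi_ (@e_op K) A (L - A)).
- by move=> i j w; apply: fermiC; rewrite andbF.
- by move=> i j w; apply: fermiC; rewrite andbF.
- by move=> i j w; apply: fermiC; rewrite andbF.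
- by move=> w m [h1 h2]; apply: e_op_window.
by split=> i iA; apply: low; lia.
Qed.

End FockSquare.

(** * Operators on single tensor factors *)

Lemma commutator_sum (R : pzRingType) (V : lmodType R) (k : nat)
    (a b : 'I_k -> {linear V -> V}) :
  (forall j l v, j != l -> a j (b l v) = b l (a j v)) -> forall v,
  commutator (fun u => \sum_j a j u) (fun u => \sum_j b j u) v =
  \sum_j commutator (a j) (b j) v.
Proof.
move=> ab v; rewrite /commutator; under eq_bigr do rewrite linear_sum.
rewrite [X in _ - X](eq_bigr (fun j => \sum_l b j (a l v))).
  rewrite [X in _ - X]exchange_big -sumrB; apply: eq_bigr => j _ /=.
  rewrite -sumrB (bigD1 j) //= big1 ?addr0 // => l lj.
  by rewrite ab ?subrr // eq_sym.
by move=> j _; rewrite linear_sum.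
Qed.

Lemma sum_comp_linear (R : pzRingType) (V : lmodType R) n
    (a b : 'I_n -> {linear V -> V}) : linear (fun v => \sum_i a i (b i v)).
Proof.
move=> c u v; rewrite scaler_sumr -big_split; apply: eq_bigr => i _.
by rewrite !linearP.
Qed.

Lemma commutator_of_comp (R : pzRingType) (W V : lmodType R)
    (at_ : (W -> W) -> {linear V -> V}) :
  (forall (A B : {linear W -> W}) v, at_ A (at_ B v) = at_ (A \o B) v) ->
  (forall c A B v, at_ (fun x => c *: A x + B x) v = c *: at_ A v + at_ B v) ->
  forall (A B : {linear W -> W}) v,
  commutator (at_ A) (at_ B) v = at_ (commutator A B) v.
Proof.
move=> at_comp at_lin A B v.
rewrite /commutator !at_comp addrC -scaleN1r -at_lin.
by congr (at_ _ _); apply/funext => x /=; rewrite scaleN1r addrC.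
Qed.

Section TensorFactors.
Variables (K : numFieldType) (k : nat).
Implicit Types (t : {ffun 'I_k -> monomial}) (j l : 'I_k) (S : monomial).
Implicit Types (x : fock K) (v : fockT K k).

Definition upd t j S : {ffun 'I_k -> monomial} :=
  [ffun i => if i == j then S else t i].

(** The slice of the tensor product through [t] along the factor [j]. *)
Definition insert t j : fock K -> fockT K k :=
  linext (fun S => << upd t j S >>).

HB.instance Definition _ t j := GRing.Linear.on (insert t j).
HB.instance Definition _ j (A : fock K -> fock K) :=
  GRing.Linear.on (@at_factor K k j A).

Lemma insertU t j S : insert t j << S >> = << upd t j S >>.
Proof. exact: linext1. Qed.

Lemma at_factorU j (A : fock K -> fock K) t :
  at_factor j A << t >> = insert t j (A << t j >>).
Proof. exact: linext1. Qed.

Lemma upd_same t j S : upd t j S j = S.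
Proof. by rewrite ffunE eqxx. Qed.

Lemma upd_id t j : upd t j (t j) = t.
Proof. by apply/ffunP => i; rewrite ffunE; case: eqP => [->|]. Qed.

Lemma insert_upd t j S : insert (upd t j S) j = insert t j.
Proof.
congr linext; apply/funext => T; congr (<< _ >>).
by apply/ffunP => i; rewrite !ffunE; case: eqP.
Qed.

Lemma at_factor_insert j (A : {linear fock K -> fock K}) t x :
  at_factor j A (insert t j x) = insert t j (A x).
Proof.
apply: (@eq_linear K _ _ (at_factor j A \o insert t j)
  (insert t j \o A)) => S /=.
by rewrite insertU at_factorU upd_same insert_upd.
Qed.

Lemma at_factor_insert2 j l (A : {linear fock K -> fock K}) t x : j != l ->
  at_factor j A (insert t l x) =
  linext (fun S => insert (upd t l S) j (A << t j >>)) x.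
Proof.
move=> /negbTE jl.
apply: (@eq_linear K _ _ (at_factor j A \o insert t l) (linext _)) => S /=.
by rewrite insertU at_factorU linext1 ffunE jl.
Qed.

(** The tensor of [x] and [y] does not depend on which factor is filled first. *)
Lemma insert2C j l t x y : j != l ->
  linext (fun S => insert (upd t l S) j x) y =
  linext (fun S => insert (upd t j S) l y) x.
Proof.
move=> /negbTE jl; rewrite /insert /linext.
under eq_bigr do rewrite scaler_sumr; under [RHS]eq_bigr do rewrite scaler_sumr.
rewrite exchange_big /=; apply: eq_bigr => S _; apply: eq_bigr => T _.
rewrite !scalerA mulrC; congr (_ *: << _ >>).
apply/ffunP => i; rewrite !ffunE.
by case: (eqVneq i j) => [->|//]; rewrite jl.
Qed.

Lemma at_factor2U j l (A B : fock K -> fock K) t :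
  at_factor j A (at_factor l B << t >>) =
  at_factor j A (insert t l (B << t l >>)).
Proof. exact: congr1 _ (at_factorU l B t). Qed.

Lemma at_factor_comm j l (A B : {linear fock K -> fock K}) v : j != l ->
  at_factor j A (at_factor l B v) = at_factor l B (at_factor j A v).
Proof.
move=> jl; apply: (@eq_linear K _ _ (at_factor j A \o at_factor l B)
  (at_factor l B \o at_factor j A)) => t.
apply: etrans (at_factor2U j l A B t) _.
apply: etrans (at_factor_insert2 A t _ jl) _.
apply: etrans (insert2C _ _ _ jl) _.
rewrite eq_sym in jl.
apply: etrans (esym (at_factor_insert2 B t _ jl)) _.
exact: esym (at_factor2U l j B A t).
Qed.

Lemma at_factor_comp j (A B : {linear fock K -> fock K}) v :
  at_factor j A (at_factor j B v) = at_factor j (A \o B) v.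
Proof.
apply: (@eq_linear K _ _ (at_factor j A \o at_factor j B)
  (at_factor j (A \o B))) => t.
apply: etrans (at_factor2U j j A B t) _.
apply: etrans (at_factor_insert j A t _) _.
exact: esym (at_factorU j (A \o B) t).
Qed.

Lemma at_factor_scale j (c : K) v : at_factor j (fun x => c *: x) v = c *: v.
Proof.
apply: (@eq_linear K _ _ (at_factor j _) (c \*: idfun)) => t /=.
by rewrite at_factorU linearZ /= insertU upd_id.
Qed.

Lemma at_factor_lin j (c : K) (A B : fock K -> fock K) v :
  at_factor j (fun x => c *: A x + B x) v =
  c *: at_factor j A v + at_factor j B v.
Proof.
apply: (@eq_linear K _ _ (at_factor j _)
  (c \*: at_factor j A \+ at_factor j B)) => t /=.
by rewrite !at_factorU linearP.
Qed.

Fact coproduct_is_linear (A : fock K -> fock K) : linear (@coproduct K k A).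
Proof.
move=> c u v; rewrite /coproduct scaler_sumr -big_split.
by apply: eq_bigr => j _; rewrite linearP.
Qed.

HB.instance Definition _ (A : fock K -> fock K) := GRing.isLinear.Build K
  (fockT K k) (fockT K k) *:%R (@coproduct K k A) (coproduct_is_linear A).

Lemma coproduct_lin (c : K) (A B : fock K -> fock K) v :
  coproduct (fun x => c *: A x + B x) v = c *: coproduct A v + coproduct B v.
Proof.
rewrite /coproduct scaler_sumr -big_split.
by apply: eq_bigr => j _; rewrite at_factor_lin.
Qed.

Lemma coproduct_scale (c : K) v : coproduct (fun x => c *: x) v = (c *+ k) *: v.
Proof.
rewrite /coproduct (eq_bigr (fun=> c *: v)) => [|j _]; last first.
  exact: at_factor_scale.
by rewrite sumr_const card_ord scalerMnl.
Qed.

Lemma coproduct_eigen (A : fock K -> fock K) t :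
  (forall j, exists c : K, A << t j >> = c *: << t j >>) ->
  exists c : K, coproduct A << t >> = c *: << t >>.
Proof.
move=> At; pose c j := sval (cid (At j)); exists (\sum_j c j).
rewrite /coproduct scaler_suml; apply: eq_bigr => j _.
by rewrite at_factorU (svalP (cid (At j))) linearZ /= insertU upd_id.
Qed.

Lemma commutator_coproduct (A B : {linear fock K -> fock K}) v :
  commutator (coproduct A) (coproduct B) v = coproduct (commutator A B) v.
Proof.
apply: etrans (commutator_sum (a := fun j => at_factor j A)
  (b := fun j => at_factor j B) _ v) _.
  by move=> j l u; apply: at_factor_comm.
apply: eq_bigr => j _.
exact: (@commutator_of_comp _ _ _ (fun A => at_factor j A) (at_factor_comp j)
  (at_factor_lin j)).
Qed.

Lemma at_factor_sqr0 j v : exists L0, forall L : int, L <= L0 -> forall n,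
  \sum_(i < n.+1) at_factor j (e_op (L + i%:Z))
    (at_factor j (e_op (L + (n - i)%N%:Z)) v) = 0.
Proof.
apply: (eventually_linear (Q := fun L n v => \sum_(i < n.+1)
  at_factor j (e_op (L + i%:Z)) (at_factor j (e_op (L + (n - i)%N%:Z)) v))).
  move=> L n; exact: (@sum_comp_linear K (fockT K k) n.+1
    (fun i => at_factor j (e_op (L + i%:Z)))
    (fun i => at_factor j (e_op (L + (n - i)%N%:Z)))).
move=> t; have [L0 h] := e_op_sqr0 (<< t j >> : fock K); exists L0 => L LL n.
apply: etrans (linear0 (insert t j)).
apply: etrans (congr1 _ (h L LL n)); rewrite linear_sum.
apply: eq_bigr => i _; apply: etrans (at_factor2U _ _ _ _ _) _.
exact: at_factor_insert.
Qed.

End TensorFactors.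

(** * Powers of a sum of commuting elements of square zero *)

Section SquareZeroSums.
Variables (U : zmodType) (G : U -> Prop) (k : nat) (C : 'I_k -> U -> U).

Hypothesis CD : forall j X Y, C j (X + Y) = C j X + C j Y.
Hypothesis C_comm : forall j l X, C j (C l X) = C l (C j X).
Hypothesis GC : forall j X, G X -> G (C j X).
Hypothesis GD : forall X Y, G X -> G Y -> G (X + Y).
Hypothesis G0 : G 0.
Hypothesis C_sqr0 : forall j X, G X -> C j (C j X) = 0.

Definition sum_op (js : seq 'I_k) (X : U) : U := \sum_(j <- js) C j X.
Definition prod_op (js : seq 'I_k) (X : U) : U := foldr C X js.

Let C0 j : C j 0 = 0.
Proof. by apply: (@addIr _ (C j 0)); rewrite -CD !add0r. Qed.

Let CMn j X n : C j (X *+ n) = C j X *+ n.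
Proof. by elim: n => [|n IH]; rewrite ?mulr0n ?C0 // !mulrS CD IH. Qed.

Let CS j js X : C j (sum_op js X) = sum_op js (C j X).
Proof.
rewrite /sum_op; elim: js => [|l js IH]; first by rewrite !big_nil C0.
by rewrite !big_cons CD IH C_comm.
Qed.

Let SD js X Y : sum_op js (X + Y) = sum_op js X + sum_op js Y.
Proof. by rewrite /sum_op -big_split; apply: eq_bigr => j _; rewrite CD. Qed.

Let SMn js X n : sum_op js (X *+ n) = sum_op js X *+ n.
Proof. by rewrite /sum_op -sumrMnl; apply: eq_bigr => j _; rewrite CMn. Qed.

Let S0 js : sum_op js 0 = 0.
Proof. by rewrite /sum_op big1 // => j _; rewrite C0. Qed.

Let GS js X : G X -> G (sum_op js X).
Proof.
move=> gX; rewrite /sum_op; elim: js => [|j js IH]; first by rewrite big_nil.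
by rewrite big_cons; apply: GD => //; apply: GC.
Qed.

Let iter_cons j js X r : G X -> iter r.+1 (sum_op (j :: js)) X =
  iter r.+1 (sum_op js) X + C j (iter r (sum_op js) X) *+ r.+1.
Proof.
move=> gX; have Scons Y : sum_op (j :: js) Y = sum_op js Y + C j Y.
  by rewrite /sum_op big_cons addrC.
elim: r => [|r IH]; first by rewrite /= Scons mulr1n.
have gr : G (iter r (sum_op js) X) by elim: r {IH} => //= r; apply: GS.
rewrite iterS IH Scons SD CD SMn CMn C_sqr0 // mul0rn addr0 -CS -!iterS.
by rewrite -addrA -mulrSr.
Qed.

(** Commuting elements of square zero: in a power of their sum only products of
    distinct elements survive. *)
Lemma sum_op_nilpotent js X : G X ->
  iter (size js).+1 (sum_op js) X = 0 /\
  iter (size js) (sum_op js) X = prod_op js X *+ (size js)`!.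
Proof.
move=> gX; elim: js => [|j js [IH1 IH2]].
  by split; rewrite /= ?mulr1n // /sum_op big_nil.
split; rewrite iter_cons //.
  by rewrite [size (j :: js)]/= iterS IH1 S0 C0 mul0rn addr0.
by rewrite IH1 add0r IH2 CMn -mulrnA factS mulnC.
Qed.

End SquareZeroSums.

(** * Words in the modes of E(z) applied to a vector *)

Section Words.
Variables (K : numFieldType) (V : lmodType K) (E : int -> {linear V -> V}).
Implicit Types (b i : int) (u v w : V) (n r : nat).

(** The module generated by [w] under the modes of index at most [b]; it is given
    inductively because all proofs about it go by induction on words. *)
Inductive words b w : V -> Prop :=
| words_gen : words b w w
| words_lin a u v : words b w u -> words b w v -> words b w (a *: u + v)
| words_op i v : i <= b -> words b w v -> words b w (E i v).

Lemma words0 b w : words b w 0.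
Proof. by rewrite -(addNr w) -scaleN1r; apply: words_lin; apply: words_gen. Qed.

Lemma wordsZ b w a v : words b w v -> words b w (a *: v).
Proof.
by move=> h; rewrite -[a *: v]addr0; apply: words_lin => //; apply: words0.
Qed.

Lemma wordsD b w u v : words b w u -> words b w v -> words b w (u + v).
Proof. by move=> hu; rewrite -[u]scale1r; apply: words_lin. Qed.

Lemma words_sum b w (I : Type) (s : seq I) (P : pred I) (F : I -> V) :
  (forall x, P x -> words b w (F x)) -> words b w (\sum_(x <- s | P x) F x).
Proof. by apply: big_ind; [apply: words0 | apply: wordsD]. Qed.

Lemma words_mono b b' w v : b <= b' -> words b w v -> words b' w v.
Proof.
move=> bb'; elim=> [|a u u' _ IH _ IH'|i u ib _ IH]; first exact: words_gen.
  exact: words_lin.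
by apply: words_op => //; apply: le_trans bb'.
Qed.

Lemma words_trans b w w' v : words b w w' -> words b w' v -> words b w v.
Proof.
move=> ww'; elim=> [//|a u u' _ IH _ IH'|i u ib _ IH]; first exact: words_lin.
exact: words_op.
Qed.

Lemma words_kill b w i : (forall i j v, E i (E j v) = E j (E i v)) ->
  E i w = 0 -> forall v, words b w v -> E i v = 0.
Proof.
move=> E_comm w0 v; elim=> [//|a u u' _ IH _ IH'|a u _ _ IH].
  by rewrite linearP IH IH' scaler0 addr0.
by rewrite E_comm IH linear0.
Qed.

Variables (lo : int) (w : V).
Let D := conv (fun i : nat => E (lo + i%:Z)).

(** No mode is below [lo], so in the coefficient of degree [n] none can exceed
    [lo + n]. *)
Lemma iter_conv_words r n : words (lo + n%:Z) w (iter r D (delta w) n).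
Proof.
elim: r n => [|r IH] n /=.
  rewrite /delta; case: eqP => _; [exact: words_gen | exact: words0].
apply: words_sum => i _; have := ltn_ord i; rewrite ltnS => i_n.
by apply: words_op; [lia | apply: words_mono (IH _); lia].
Qed.

Section Top.
Variable beta : nat.
Let b := lo + beta%:Z.
Let I r n := iter r D (delta w) n.
Let T r n := \sum_(i < n.+1 | (beta <= i)%N) E (lo + i%:Z) (I r (n - i)%N).

Hypothesis E_comm : forall i j v, E i (E j v) = E j (E i v).

Let IE r n : I r.+1 n = \sum_(i < n.+1) E (lo + i%:Z) (I r (n - i)%N).
Proof. by []. Qed.

Let T_shift r n : (n < beta + beta)%N ->
  \sum_(i < n.+1 | (i < beta)%N) E (lo + i%:Z) (T r (n - i)%N) = T r.+1 n.
Proof.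
(* In degree less than [2 * beta] the condition [i < beta] is implied by
   [beta <= l]. *)
move=> n2.
pose F (i l : nat) := E (lo + i%:Z) (E (lo + l%:Z) (I r (n - (i + l))%N)).
transitivity (\sum_(i < n.+1 | (i < beta)%N)
                \sum_(l < n.+1 | (i + l <= n)%N && (beta <= l)%N) F i l).
  apply: eq_bigr => i ib; rewrite /T linear_sum.
  rewrite (big_ord_widen_cond n.+1 (fun l => beta <= l)%N
    (fun l => E (lo + i%:Z) (E (lo + l%:Z) (I r (n - i - l)%N)))); last first.
    by rewrite ltnS leq_subr.
  apply: eq_big => [l|l _]; last by rewrite /F subnDA.
  by have := ltn_ord i; lia.
transitivity (\sum_(l < n.+1 | (beta <= l)%N)
                \sum_(i < n.+1 | (i + l <= n)%N) F i l).
  rewrite (exchange_big_dep (fun l : 'I_n.+1 => beta <= l)%N) /=; last first.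
    by move=> i l _ /andP[].
  by apply: eq_bigr => l bl; apply: eq_bigl => i; lia.
apply: eq_bigr => l bl; rewrite IE linear_sum.
rewrite [RHS](big_ord_widen n.+1
  (fun q => E (lo + l%:Z) (E (lo + q%:Z) (I r (n - l - q)%N)))); last first.
  by rewrite ltnS leq_subr.
apply: eq_big => [i|i _]; first by have := ltn_ord l; lia.
by rewrite /F E_comm addnC subnDA.
Qed.

(* A coefficient of [E(z)^(r+1) w] of degree less than [2 * beta] involves at most
   one mode of index at least [b], which can stand at [r + 1] places. *)
Let top_term r n : (n < beta + beta)%N ->
  words (b - 1) w (I r.+1 n - T r n *+ r.+1).
Proof.
have split_I q m : I q.+1 m =
    \sum_(i < m.+1 | (i < beta)%N) E (lo + i%:Z) (I q (m - i)%N) + T q m.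
  rewrite IE (bigID (fun i : 'I_m.+1 => (i < beta)%N)) /=; congr (_ + _).
  by apply: eq_bigl => i; rewrite -leqNgt.
elim: r n => [|r IH] n n2.
  rewrite split_I mulr1n addrK; apply: words_sum => i ib; apply: words_op.
    by rewrite /b; lia.
  rewrite /I /= /delta; case: eqP => _; [exact: words_gen | exact: words0].
rewrite split_I mulrS opprD addrA addrK -T_shift // -sumrMnl -sumrB.
apply: words_sum => i ib; rewrite -linearMn -linearB; apply: words_op.
  by rewrite /b; lia.
by apply: IH; lia.
Qed.

(** Where a power of [E(z)] vanishes on [w], its coefficient of degree [N + beta]
    is a relation in which the only word with a mode of index at least [b] is
    [E b] applied to the lowest coefficient of the previous power. *)
Lemma words_top r N x w' : x != 0 -> (N < beta)%N ->
  (forall n, I r.+1 n = 0) -> (forall n, (n < N)%N -> I r n = 0) ->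
  I r N = x *: w' -> words (b - 1) w (E b w').
Proof.
move=> x0 Nb Ir1 Ir0 IrN.
have N2 : (N + beta < beta + beta)%N by rewrite ltn_add2r.
have := top_term r N2; rewrite Ir1 sub0r.
have -> : T r (N + beta)%N = x *: E b w'.
  have bN : (beta < (N + beta).+1)%N by rewrite ltnS leq_addl.
  rewrite /T (bigD1 (Ordinal bN)) //= addnK IrN linearZ big1 /= ?addr0 // => i.
  rewrite -val_eqE /= => /andP[bi ib].
  by rewrite Ir0 ?linear0 //; have := ltn_ord i; lia.
rewrite -scaler_nat scalerA -scaleNr => /(wordsZ (- (r.+1%:R * x))^-1).
rewrite scalerA mulVf ?scale1r // oppr_eq0 mulf_neq0 // pnatr_eq0 //.
Qed.

End Top.
End Words.

(** * The top powers of the total current on a vacuum *)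

Section SumOfCurrents.
Variables (K : numFieldType) (V : lmodType K) (k : nat).
Variables (c : 'I_k -> int -> {linear V -> V}) (E : int -> {linear V -> V}).
Implicit Types (i a : int) (j l : 'I_k) (n : nat) (v : V) (X Y : nat -> V).

Hypothesis EE : forall i v, E i v = \sum_j c j i v.
Hypothesis c_comm : forall j l a i v, c j a (c l i v) = c l i (c j a v).
Hypothesis c_sqr0 : forall j v, exists L0, forall L : int, L <= L0 -> forall n,
  \sum_(q < n.+1) c j (L + q%:Z) (c j (L + (n - q)%N%:Z) v) = 0.

Lemma sum_comm i a v : E i (E a v) = E a (E i v).
Proof.
rewrite ![E _ (E _ v)]EE.
under eq_bigr do rewrite EE linear_sum.
under [RHS]eq_bigr do rewrite EE linear_sum.
rewrite exchange_big; apply: eq_bigr => j _; apply: eq_bigr => l _.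
exact: c_comm.
Qed.

Variable lo : int.

Let killed v := forall j i, i < lo -> c j i v = 0.

(* Modes below [lo] do not act on [v], so sums may as well start at [lo]. *)
Let sqr_window j v n : killed v ->
  \sum_(q < n.+1) c j (lo + q%:Z) (c j (lo + (n - q)%N%:Z) v) = 0.
Proof.
move=> v0; have [L0 h] := c_sqr0 j v; pose L := Num.min L0 lo.
have L_lo : L <= lo by rewrite ge_min lexx orbT.
have L_L0 : L <= L0 by rewrite ge_min lexx.
pose t := `|lo - L|%N; have Lt : L + t%:Z = lo by lia.
pose f q := c j (L + q%:Z) (c j (L + (n + t + t - q)%N%:Z) v).
have f0 q : (q < t)%N || (n + t < q <= n + t + t)%N -> f q = 0.
  case/orP=> hq; rewrite /f; first by rewrite c_comm v0 ?linear0 //; lia.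
  by rewrite [c j _ v]v0 ?linear0 //; lia.
rewrite -[RHS](h L L_L0 (n + t + t)%N) -(big_mkord xpredT f).
rewrite (big_cat_nat (n := t)) //=; last by lia.
rewrite [X in _ = X + _]big_nat [X in _ = X + _]big1 ?add0r => [|q]; last first.
  by move=> /andP[_ qt]; rewrite f0 ?qt.
rewrite (big_cat_nat (n := (n.+1 + t)%N)) //=; [|lia|lia].
rewrite [X in _ = _ + X]big_nat [X in _ = _ + X]big1 ?addr0 => [|q hq];
  last by rewrite f0 //; lia.
rewrite -{1}[t]add0n big_addn addnK big_mkord; apply: eq_bigr => q _.
rewrite /f; have := ltn_ord q => qn.
by congr (c j _ (c j _ v)); lia.
Qed.

Let C j X := conv (fun q : nat => c j (lo + q%:Z)) X.
Let D X := conv (fun q : nat => E (lo + q%:Z)) X.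
Let G X := forall n, killed (X n).

Let C_comm j l X : C j (C l X) = C l (C j X).
Proof. by apply: conv_swap => *; apply: c_comm. Qed.

Let GC j X : G X -> G (C j X).
Proof.
move=> gX n l i i_lo; rewrite /C /conv linear_sum big1 // => q _.
by rewrite c_comm gX ?linear0.
Qed.

Let CC j X : G X -> C j (C j X) = 0.
Proof.
move=> gX; apply/funext => n; rewrite /C conv_conv big1 // => q _.
exact: sqr_window.
Qed.

Let DE X : D X = sum_op C (enum 'I_k) X.
Proof.
apply/funext => n; rewrite /sum_op big_enum fct_sumE /D /C /conv exchange_big.
by apply: eq_bigr => q _; rewrite EE.
Qed.

Let D_nilpotent X : G X -> iter k.+1 D X = 0 /\
  iter k D X = prod_op C (enum 'I_k) X *+ k`!.
Proof.
move=> gX; have -> : D = sum_op C (enum 'I_k) by apply/funext => Y; apply: DE.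
have := @sum_op_nilpotent _ G k C _ C_comm GC _ _ CC (enum 'I_k) X gX.
rewrite size_enum_ord; apply.
- by move=> j Y Z; apply/funext => n; apply: convD.
- by move=> Y Z gY gZ n j i i_lo; rewrite linearD gY // gZ // addr0.
- by move=> n j i i_lo; rewrite linear0.
Qed.

Variable vacuum : {ffun 'I_k -> int} -> V.

Definition raise (m : {ffun 'I_k -> int}) (js : seq 'I_k) :
    {ffun 'I_k -> int} :=
  [ffun j => m j + (if j \in js then 2 else 0)].

Hypothesis vacuum_kill : forall (m : {ffun 'I_k -> int}) j i,
  i <= m j -> c j i (vacuum m) = 0.
Hypothesis vacuum_next : forall (m : {ffun 'I_k -> int}) j,
  exists2 x : K, x != 0 &
  c j (m j + 1) (vacuum m) = x *: vacuum (raise m [:: j]).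

Variable m : {ffun 'I_k -> int}.
Hypothesis lo_m : forall j, lo <= m j + 1.

Let depth (js : seq 'I_k) := (\sum_(j <- js) absz (m j + 1 - lo)%R)%N.

(* In the lowest coefficient of a product of currents of distinct factors, each of
   them contributes the lowest mode that does not kill its vacuum. *)
Let lead js : uniq js ->
  (forall n, (n < depth js)%N -> prod_op C js (delta (vacuum m)) n = 0) /\
  exists2 x : K, x != 0 &
    prod_op C js (delta (vacuum m)) (depth js) = x *: vacuum (raise m js).
Proof.
elim: js => [_|j js IH /= /andP[j_js /IH [Y0 [x x0 Yd]]]].
  rewrite /depth big_nil; split=> //; exists 1; rewrite ?oner_eq0 //= scale1r.
  by rewrite /delta /=; congr vacuum; apply/ffunP => j; rewrite ffunE addr0.
pose Y := prod_op C js (delta (vacuum m)); rewrite -/Y in Y0 Yd *.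
have Ykill a n : a <= m j -> c j a (Y n) = 0.
  move=> am; rewrite /Y; elim: (js) n => [|l s IHs] n /=.
    by rewrite /delta; case: eqP => _; rewrite ?linear0 ?vacuum_kill.
  rewrite /C /conv linear_sum big1 // => q _.
  by rewrite c_comm IHs linear0.
have depthE : depth (j :: js) = (absz (m j + 1 - lo)%R + depth js)%N.
  by rewrite /depth big_cons.
have lomj := lo_m j; split=> [n n_lt|].
  rewrite depthE in n_lt.
  rewrite /C /conv big1 // => q _; have qn := ltn_ord q.
  have [qm|mq] := leP (lo + q%:Z) (m j); first exact: Ykill.
  by rewrite Y0 ?linear0 //; lia.
have [y y0 hy] := vacuum_next (raise m js) j.
exists (x * y); first by rewrite mulf_neq0.
rewrite /C /conv depthE.
have jn : (absz (m j + 1 - lo)%R < (absz (m j + 1 - lo)%R + depth js).+1)%N.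
  by rewrite ltnS leq_addr.
rewrite (bigD1 (Ordinal jn)) //= [X in (X - _)%N]addnC addnK Yd.
rewrite big1 ?addr0 => [|q].
  rewrite linearZ /= (_ : lo + _ = raise m js j + 1); last first.
    by rewrite ffunE (negbTE j_js); lia.
  rewrite hy scalerA; congr (_ *: vacuum _); apply/ffunP => l.
  rewrite !ffunE !inE; case: eqVneq => [->|_].
    by rewrite (negbTE j_js) addr0.
  by rewrite /= addr0.
rewrite -val_eqE /= => qj; have qn := ltn_ord q.
have [qm|mq] := leP (lo + q%:Z) (m j); first exact: Ykill.
by rewrite Y0 ?linear0 //; lia.
Qed.

Definition gap := (\sum_j absz (m j + 1 - lo)%R)%N.
Definition raise_all : {ffun 'I_k -> int} := [ffun j => m j + 2].

Let good_vacuum : G (delta (vacuum m)).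
Proof.
move=> n j i i_lo; rewrite /delta; case: eqP => _; rewrite ?linear0 //.
by apply: vacuum_kill; have := lo_m j; lia.
Qed.

Let power_vacuum :
  (forall n, (n < gap)%N -> iter k D (delta (vacuum m)) n = 0) /\
  exists2 x : K, x != 0 &
    iter k D (delta (vacuum m)) gap = x *: vacuum raise_all.
Proof.
have [L0 [x x0 Lx]] := lead (enum_uniq 'I_k).
have depthE : depth (enum 'I_k) = gap by rewrite /depth /gap big_enum.
have [_ ->] := D_nilpotent good_vacuum.
have MnE Y q n : (Y *+ q) n = Y n *+ q :> V.
  by elim: q => [|q IH]; rewrite ?mulr0n // !mulrS -IH.
split=> [n n_lt|]; first by rewrite MnE L0 ?mul0rn ?depthE.
exists (k`!%:R * x); first by rewrite mulf_neq0 // pnatr_eq0 -lt0n fact_gt0.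
rewrite MnE -depthE Lx -scaler_nat scalerA; congr (_ *: vacuum _).
by apply/ffunP => j; rewrite !ffunE mem_enum.
Qed.

(** The lowest nonzero coefficient of [E(z)^k] on [vacuum m] is a multiple of the
    raised vacuum. *)
Lemma raised_in_words :
  words E (lo + gap%:Z) (vacuum m) (vacuum raise_all).
Proof.
have [_ [x x0 hx]] := power_vacuum.
rewrite -[vacuum raise_all]scale1r -(mulVf x0) -scalerA -hx.
by apply: wordsZ; apply: iter_conv_words.
Qed.

(** The relation comes from [E(z)^(k+1) = 0] on [vacuum m]. *)
Lemma top_mode_in_words b : lo + gap%:Z < b ->
  words E (b - 1) (vacuum m) (E b (vacuum raise_all)).
Proof.
move=> gap_b; have [h0 [x x0 hx]] := power_vacuum.
pose beta := `|b - lo|%N; have betaE : lo + beta%:Z = b by lia.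
rewrite -betaE; apply: (@words_top K V E lo (vacuum m) beta _ k gap x) => //.
- exact: sum_comm.
- by lia.
by move=> n; rewrite (D_nilpotent good_vacuum).1.
Qed.

End SumOfCurrents.

(** * The limit of the chain *)

Section Chain.
Variables (K : numFieldType) (V : lmodType K) (E : int -> {linear V -> V}).
Variables (w : nat -> V) (B0 : int).
Implicit Types (b i a : int) (u v : V) (s : nat).

Let B s : int := B0 - s%:Z.

Hypothesis E_comm : forall i a v, E i (E a v) = E a (E i v).
Hypothesis w_next : forall s, words E (B s) (w s.+1) (w s).
Hypothesis w_top : forall s b, B s < b -> words E (b - 1) (w s.+1) (E b (w s)).

Lemma words_up b s s' v : B s <= b -> (s <= s')%N ->
  words E b (w s) v -> words E b (w s') v.
Proof.
move=> Bs /subnK <-; elim: (s' - s)%N => [//|d IH] h; rewrite addSn.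
apply: words_trans (IH h); apply: words_mono (w_next _).
by rewrite /B in Bs *; lia.
Qed.

Let top_op b s v : B s < b -> words E (b - 1) (w s) v ->
  words E (b - 1) (w s.+1) (E b v).
Proof.
move=> Bb; elim=> [|a u u' _ IH _ IH'|i u ib _ IH]; first exact: w_top.
  by rewrite linearP; apply: words_lin.
by rewrite E_comm; apply: words_op.
Qed.

Let words_lower1 b s v : B s < b -> words E b (w s) v ->
  exists2 s', (s <= s')%N & words E (b - 1) (w s') v.
Proof.
move=> Bb; elim=> [|a u u' _ [s1 ss1 IH1] _ [s2 ss2 IH2]|i u ib _ [s1 ss1 IH]].
- by exists s.+1 => //; apply: words_mono (w_next s); lia.
- exists (maxn s1 s2); first by rewrite leq_max ss1.
  apply: words_lin; [move: IH1 | move: IH2]; apply: words_up;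
    rewrite ?leq_maxl ?leq_maxr //; rewrite /B in Bb *; lia.
have [i_b|b_i] := ltP i b; first by exists s1 => //; apply: words_op => //; lia.
rewrite (_ : i = b); last by lia.
exists s1.+1; first by apply: ltnW.
by apply: top_op => //; rewrite /B in Bb *; lia.
Qed.

(** First moving far enough down the chain that [b'] exceeds the bound of
    [w_top], the top index can then be lowered one unit at a time. *)
Lemma words_lower b b' s v : words E b (w s) v ->
  exists s0, forall s', (s0 <= s')%N -> words E b' (w s') v.
Proof.
move=> h; pose b1 := Num.max (Num.max b b') (B s).
have h1 : words E b1 (w s) v by apply: words_mono h; rewrite /b1 !le_max lexx.
have b'1 : b' <= b1 by rewrite /b1 !le_max lexx orbT.
have Bs1 : B s <= b1 by rewrite /b1 !le_max lexx orbT.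
pose s1 := (s + `|B s - b'|.+1)%N.
have Bs : B s1 < b' by rewrite /s1 /B; lia.
have {}h1 : words E b1 (w s1) v by apply: words_up h1 => //; rewrite /s1; lia.
have [d b'E] : exists d : nat, b' = b1 - d%:Z by exists `|b1 - b'|%N; lia.
suff [s2 s12 h2] : exists2 s2, (s1 <= s2)%N & words E b' (w s2) v.
  exists s2 => s' s2s'; apply: words_up h2 => //.
  by rewrite /B in Bs *; lia.
have: b' <= b1 - d%:Z by rewrite b'E.
rewrite [in X in words _ X]b'E {b'E}; elim: d => [|d IH] b'd.
  by exists s1 => //; rewrite subr0.
have [|s2 s12 h2] := IH; first by lia.
have [|s3 s23 h3] := words_lower1 _ h2; first by rewrite /B in Bs *; lia.
exists s3; first exact: leq_trans s23.
by rewrite (_ : b1 - _ = b1 - d%:Z - 1) //; lia.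
Qed.

Definition limit v := exists s b, words E b (w s) v.

Lemma limit_words b s v : words E b (w s) v -> limit v.
Proof. by exists s, b. Qed.

Lemma limit_lin (x : K) u v : limit u -> limit v -> limit (x *: u + v).
Proof.
move=> [s1 [b1 h1]] [s2 [b2 h2]].
have [t1 {}h1] := words_lower 0 h1; have [t2 {}h2] := words_lower 0 h2.
exists (maxn t1 t2), 0; apply: words_lin.
  by apply: h1; rewrite leq_maxl.
by apply: h2; rewrite leq_maxr.
Qed.

Lemma limitZ (x : K) v : limit v -> limit (x *: v).
Proof. by move=> [s [b h]]; exists s, b; apply: wordsZ. Qed.

Lemma limitD u v : limit u -> limit v -> limit (u + v).
Proof. by move=> hu; rewrite -[u]scale1r; apply: limit_lin. Qed.

Lemma limit_E i v : limit v -> limit (E i v).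
Proof.
move=> [s [b h]]; exists s, (Num.max i b); apply: words_op.
  by rewrite le_max lexx.
by apply: words_mono h; rewrite le_max lexx orbT.
Qed.

Variables (F H : int -> {linear V -> V}).
Hypothesis EF : forall a b, exists x : K, forall v,
  commutator (E a) (F b) v = H (a + b) v + x *: v.
Hypothesis HE : forall a b, exists x : K, forall v,
  commutator (H a) (E b) v = 2 *: E (a + b) v + x *: v.
Hypothesis E_w : forall s, exists a, E a (w s) = 0.
Hypothesis F_w : forall i, exists s0, forall s, (s0 <= s)%N -> F i (w s) = 0.
Hypothesis H_w : forall i s, i <= 0 -> exists x : K, H i (w s) = x *: w s.

Let limitN v : limit v -> limit (- v).
Proof. by rewrite -scaleN1r; apply: limitZ. Qed.

Let words_H s (P : int -> Prop) : (forall j, P j -> limit (H j (w s))) ->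
  forall b v, words E b (w s) v -> forall j, P j -> limit (H j v).
Proof.
move=> Pw b v; elim=> [//|a u u' _ IH _ IH'|i u ib hu IH] j Pj.
  by rewrite linearP; apply: limit_lin; [apply: IH | apply: IH'].
have [x hx] := HE j i; rewrite (commutatorE (H j)) hx.
apply: limitD; first by apply/limit_E/IH.
apply: limitD; apply: limitZ; last exact: limit_words hu.
exact/limit_E/(limit_words hu).
Qed.

Let FE i a v : exists x : K, F i (E a v) = E a (F i v) - (H (a + i) v + x *: v).
Proof.
have [x hx] := EF a i; exists x.
by rewrite -hx /commutator opprB addrC subrK.
Qed.

(* Once [w s] is written with modes of index at most [- i] on [w t], where [F i]
   kills [w t], moving [F i] to the right only produces modes [H j] with [j <= 0],
   and these act on [w t] by scalars. *)
Let limit_F_w i s : limit (F i (w s)).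
Proof.
have [s0 Fs0] := F_w i; have [s1 h] := words_lower (- i) (words_gen E 0 (w s)).
pose t := maxn s0 s1; have {}h : words E (- i) (w t) (w s).
  by apply: h; rewrite leq_maxr.
have Fw : F i (w t) = 0 by apply: Fs0; rewrite leq_maxl.
have Hw j : j <= 0 -> limit (H j (w t)).
  by move=> /H_w -/(_ t) [x ->]; apply/limitZ/(limit_words (words_gen E 0 _)).
elim: h => [|a u u' _ IH _ IH'|a u ab hu IH].
- by rewrite Fw; apply: limit_words (words0 E 0 (w 0%N)).
- by rewrite linearP; apply: limit_lin.
have [x ->] := FE i a u; apply: limitD; first exact: limit_E.
apply/limitN/limitD; last exact: limitZ (limit_words hu).
by apply: (words_H Hw hu); lia.
Qed.

(* With [E a] killing [w s], [H j (w s)] is [E a (F (j - a) (w s))] up to a multiple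
   of [w s]. *)
Let limit_H_w j s : limit (H j (w s)).
Proof.
have [a Ea] := E_w s; have [x hx] := EF a (j - a).
have -> : H j (w s) = E a (F (j - a) (w s)) - x *: w s.
  have := hx (w s); rewrite /commutator Ea linear0 subr0 => ->.
  by rewrite addrK (_ : a + (j - a) = j) //; lia.
apply: limitD; first exact/limit_E/limit_F_w.
exact/limitN/limitZ/(limit_words (words_gen E 0 _)).
Qed.

Lemma limit_H j v : limit v -> limit (H j v).
Proof.
move=> [s [b h]].
by apply: (words_H (P := fun=> True) (fun i _ => limit_H_w i s) h).
Qed.

Lemma limit_F i v : limit v -> limit (F i v).
Proof.
move=> [s [b h]]; elim: h => [|a u u' _ IH _ IH'|a u ab hu IH].
- exact: limit_F_w.
- by rewrite linearP; apply: limit_lin.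
have [x ->] := FE i a u; apply: limitD; first exact: limit_E.
apply/limitN/limitD; last exact: limitZ (limit_words hu).
exact/limit_H/(limit_words hu).
Qed.

End Chain.

(** * The limit module is stable *)

Section CoproductScalars.
Variables (K : numFieldType) (W V : lmodType K) (k : nat).
Variable cop : (W -> W) -> V -> V.
Hypothesis cop_lin : forall (c : K) (A B : W -> W) v,
  cop (fun x => c *: A x + B x) v = c *: cop A v + cop B v.
Hypothesis cop_scale : forall (c : K) v,
  cop (fun x => c *: x) v = (c *+ k) *: v.

Lemma cop_addscalar (A B : W -> W) (c a : K) v :
  (forall u, A u = a *: B u + c *: u) -> cop A v = a *: cop B v + (c *+ k) *: v.
Proof. by move=> /funext ->; rewrite cop_lin cop_scale. Qed.

Variables (L : V -> Prop) (h e f : int -> W -> W).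
Hypothesis L_lin : forall (c : K) u v, L u -> L v -> L (c *: u + v).
Hypothesis L0 : L 0.
Hypothesis Lh : forall i v, L v -> L (cop (h i) v).
Hypothesis Le : forall i v, L v -> L (cop (e i) v).
Hypothesis Lf : forall i v, L v -> L (cop (f i) v).

Lemma cop_action (s : seq int) (a b c : int -> K) (z : K) v : L v ->
  L (cop (fun u => \sum_(i <- s) (a i *: h i u + b i *: e i u + c i *: f i u)
                   + z *: u) v).
Proof.
move=> Lv; elim: s => [|i s IH].
  rewrite (_ : (fun u => _) = fun u => z *: u); last first.
    by apply/funext => u; rewrite big_nil add0r.
  by rewrite cop_scale -[_ *: _]addr0; apply: L_lin.
pose r u := \sum_(i <- s) (a i *: h i u + b i *: e i u + c i *: f i u) + z *: u.
rewrite (_ : (fun u => _) =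
  fun u => a i *: h i u + (b i *: e i u + (c i *: f i u + r u))); last first.
  by apply/funext => u; rewrite big_cons !addrA.
rewrite !cop_lin; apply: L_lin; first exact: Lh.
by apply: L_lin; [exact: Le | apply: L_lin => //; exact: Lf].
Qed.

End CoproductScalars.

Lemma msupp_linextU (K : fieldType) (I J : choiceType) (g : I -> J)
    (p : {malg K[I]}) y : y \in msupp (linext (fun x => << g x >>) p) ->
  exists2 x, x \in msupp p & y = g x.
Proof.
rewrite -mcoeff_neq0; apply: contra_neqP => h.
rewrite /linext raddf_sum /= big_seq big1 // => x xp.
rewrite mcoeffZ mcoeffU; case: eqP => [gx|]; last by rewrite mulr0.
by case: h; exists x.
Qed.

Section LimitModule.
Variables (K : numFieldType) (k : nat) (d : 'I_k.+1 -> nat).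
Implicit Types (m : {ffun 'I_k -> int}) (j l : 'I_k) (i a b : int) (s n : nat).
Implicit Types (v : fockT K k).

Let E i : {linear fockT K k -> fockT K k} := coproduct (@e_op K i).
Let F i : {linear fockT K k -> fockT K k} := coproduct (@f_op K i).
Let H i : {linear fockT K k -> fockT K k} := coproduct (@h_op K i).
Let c j i : {linear fockT K k -> fockT K k} := at_factor j (@e_op K i).

Let EE i v : E i v = \sum_j c j i v. Proof. by []. Qed.

Let c_comm j l a i v : c j a (c l i v) = c l i (c j a v).
Proof.
have [->|jl] := eqVneq j l; last exact: at_factor_comm.
apply: etrans (at_factor_comp _ _ _ _) _.
apply: etrans (esym (at_factor_comp _ _ _ _)).
have eia : @e_op K a \o @e_op K i = @e_op K i \o @e_op K a.
  by apply/funext => u; apply: e_op_comm.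
exact: (congr1 (fun A => @at_factor K k l A v) eia).
Qed.

Definition vacuum m : fockT K k := << [ffun j => vac (m j)] >>.

Let vacuum_kill m j i : i <= m j -> c j i (vacuum m) = 0.
Proof.
move=> im; apply: etrans (at_factorU _ _ _) _; rewrite ffunE e_vac //.
exact: linear0.
Qed.

Let vacuum_next m j : exists2 x : K, x != 0 &
  c j (m j + 1) (vacuum m) = x *: vacuum (raise m [:: j]).
Proof.
have [x x0 hx] := e_vac_next K (m j); exists x => //.
apply: etrans (at_factorU _ _ _) _; rewrite ffunE hx.
apply: etrans (linearZZ (insert _ _) _ _) _; apply: (congr1 ( *:%R x)).
apply: etrans (@insertU K k _ j (vac (m j + 2))) _; congr (<< _ >>).
apply/ffunP => l; rewrite !ffunE inE.
by case: eqP => [->|]; rewrite ?addr0.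
Qed.

Let depth s : {ffun 'I_k -> int} := [ffun j => - (beta d j)%:Z - (2 * s)%N%:Z].
(* No mode below [lo s] acts on [w s.+1]. *)
Let lo s : int := - (Defs.total d)%:Z - (2 * s)%N%:Z - 1.

Lemma w_vecE s : w_vec K d s = vacuum (depth s).
Proof. by congr (<< _ >>); apply/ffunP => j; rewrite !ffunE. Qed.

Let beta_total j : (beta d j <= Defs.total d)%N.
Proof.
by rewrite /beta /Defs.total big_mkcond; apply: leq_sum => l _; case: ifP.
Qed.

Let lo_depth s j : lo s <= depth s.+1 j + 1.
Proof. by rewrite ffunE /lo; have := beta_total j; lia. Qed.

Let raise_depth s : raise_all (depth s.+1) = depth s.
Proof. by apply/ffunP => j; rewrite !ffunE; lia. Qed.

Let g := (\sum_(j < k) (Defs.total d - beta d j))%N.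

Let gapE s : gap (lo s) (depth s.+1) = g.
Proof.
apply: eq_bigr => j _; rewrite ffunE /lo; have := beta_total j; lia.
Qed.

(* The words produced on [w s.+1] have modes of index at most [lo s + g], and this
   is at most [B0 - s]. *)
Let B0 : int := g%:Z.
Let w s := vacuum (depth s).

Let w_next s : words E (B0 - s%:Z) (w s.+1) (w s).
Proof.
have := raised_in_words EE c_comm (@at_factor_sqr0 K k) vacuum_kill vacuum_next
  (lo_depth s).
by rewrite raise_depth gapE; apply: words_mono; rewrite /lo /B0; lia.
Qed.

Let w_top s b : B0 - s%:Z < b -> words E (b - 1) (w s.+1) (E b (w s)).
Proof.
move=> h; have := top_mode_in_words EE c_comm (@at_factor_sqr0 K k) vacuum_kill
  vacuum_next (lo_depth s).
by rewrite raise_depth gapE; apply; rewrite /lo; move: h; rewrite /B0; lia.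
Qed.

Let E_comm i a v : E i (E a v) = E a (E i v).
Proof. exact: (sum_comm EE c_comm). Qed.

Let cop_scalar (A B : fock K -> fock K) (x a : K) v :=
  @cop_addscalar K _ _ k (@coproduct K k) (@coproduct_lin K k)
    (@coproduct_scale K k) A B x a v.

Let EF a b : exists x : K, forall v,
  commutator (E a) (F b) v = H (a + b) v + x *: v.
Proof.
have [x hx] := ef_op_comm K a b; exists (x *+ k) => v.
apply: etrans (commutator_coproduct _ _ _) _.
rewrite -[H (a + b) v]scale1r; apply: cop_scalar => u.
by rewrite scale1r hx.
Qed.

Let HE a b : exists x : K, forall v,
  commutator (H a) (E b) v = 2 *: E (a + b) v + x *: v.
Proof.
have [x hx] := he_op_comm K a b; exists (x *+ k) => v.
apply: etrans
  (commutator_coproduct (commutator (e_op 0) (f_op a)) (e_op b) v) _.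
exact: cop_scalar.
Qed.

Let E_w s i : i <= - (Defs.total d)%:Z - (2 * s)%N%:Z -> E i (w s) = 0.
Proof.
move=> h; rewrite EE big1 // => j _; apply: vacuum_kill.
by rewrite ffunE; have := beta_total j; lia.
Qed.

Let E_w_ex s : exists a, E a (w s) = 0.
Proof. by exists (- (Defs.total d)%:Z - (2 * s)%N%:Z); apply: E_w. Qed.

Let F_w i : exists s0, forall s, (s0 <= s)%N -> F i (w s) = 0.
Proof.
exists `|i|%N => s s0s; apply: big1 => j _; apply: etrans (at_factorU _ _ _) _.
rewrite ffunE f_vac ?ffunE; last by lia.
exact: linear0.
Qed.

Let H_w i s : i <= 0 -> exists x : K, H i (w s) = x *: w s.
Proof.
by move=> i0; apply: coproduct_eigen => j; rewrite ffunE; apply: h_vac.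
Qed.

Let evalw s : {malg K[seq int]} -> fockT K k :=
  linext (fun r : seq int => foldr (@eT K k) (w_vec K d s) r).

Let M_words s v : M_sub d s v -> words E 0 (w s) v.
Proof.
case=> p [hp ->]; rewrite big_seq; apply: words_sum => r /hp rp.
apply: wordsZ; elim: r rp => [_|i r IH] /=.
  by rewrite w_vecE; apply: words_gen.
by case/andP=> /andP[_ i0] /IH; apply: words_op.
Qed.

Let words_M s v : words E 0 (w s) v -> M_sub d s v.
Proof.
elim=> [|a u u' _ [p [hp ->]] _ [p' [hp' ->]]|i u i0 hu [p [hp up]]].
- exists << [::] >>; split; last first.
    by rewrite -[RHS]/(evalw s _) /evalw linext1 w_vecE.
  by move=> r /(fsubsetP msuppU_le); rewrite inE => /eqP ->.
- exists (a *: p + p'); split; last first.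
    by rewrite -[RHS]/(evalw s _) /evalw linearP.
  move=> r /(fsubsetP (msuppD_le _ _)); rewrite inE => /orP[|/hp' //].
  by move/(fsubsetP (msuppZ_le _ _))/hp.
(* Modes below the range allowed in [M_sub] kill the generator. *)
have [i_lo|lo_i] := leP i (- (Defs.total d)%:Z - (2 * s)%N%:Z).
  exists 0; split; first by move=> r; rewrite msupp0 inE.
  rewrite -[RHS]/(evalw s _) /evalw linear0.
  exact: (words_kill E_comm (E_w i_lo) hu).
pose q : {malg K[seq int]} := linext (fun r => << i :: r >>) p.
exists q; split.
  move=> _ /msupp_linextU [r /hp rp ->] /=; rewrite rp andbT; lia.
rewrite up -[RHS]/(evalw s _) /q.
apply: (@eq_linear K _ _ (E i \o evalw s) (evalw s \o linext _)) => r /=.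
by rewrite /evalw !linext1.
Qed.

(** By [words_lower] with the bound [0], [LD] consists of all words in all modes on
    all the vacua of the chain, so the stability of that limit applies. *)
Lemma LD_closed (x : sl2hat K) v : LD d v -> LD d (fockT_act x v).
Proof.
pose L := limit E w.
have LD_L u : LD d u -> L u by case=> s _ /M_words; apply: limit_words.
have L_LD u : L u -> LD d u.
  case=> s [b h]; have [s0 {}h] := words_lower E_comm w_next w_top 0 h.
  exists (maxn 1 s0); first exact: leq_maxl.
  by apply/words_M/h/leq_maxr.
move=> /LD_L Lv; apply: L_LD.
apply: (@cop_action K _ _ k (@coproduct K k) (@coproduct_lin K k)
  (@coproduct_scale K k) L (@h_op K) (@e_op K) (@f_op K)) => //.
- by move=> a u u'; apply: limit_lin E_comm w_next w_top a u u'.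
- exact: limit_words (words0 E 0 (w 0%N)).
- by move=> i u; apply: (limit_H E_comm w_next w_top EF HE E_w_ex F_w H_w).
- by move=> i u; apply: limit_E.
- by move=> i u; apply: (limit_F E_comm w_next w_top EF HE E_w_ex F_w H_w).
Qed.

End LimitModule.

Theorem proposition3p2 (R : realType) (k : nat) (d : 'I_k.+1 -> nat)
    (hk : (1 <= k)%N) (hd : (d ord_max <= 1)%N)
    (x : sl2hat R[i]) (v : fockT R[i] k) :
  LD d v -> LD d (fockT_act x v).
Proof. exact: LD_closed. Qed.
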